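(* In the setting described in the context (with $\bar{B}$ and $\tilde{B}$ as constructed there), $B=\mathfrak{K}(p,\bar{B}\cup\tilde{B})$, regarded as the point set of $\Pi_3$ consisting of the affine points of the cone together with the point $X$, is a minimal blocking set of $\Pi_3=PG(3,q^6)$ not equivalent to any blocking set of class MPS.
   Context: All dimensions are projective. Let $q$ be a prime power. Let $\Sigma$ be a hyperplane of $PG(9,q^2)$ and $\mathcal{S}$ a Desarguesian $2$-spread of $\Sigma\cong PG(8,q^2)$: identifying $\Sigma$ with the projective space of the $\mathbb{F}_{q^2}$-vector space $\mathbb{F}_{q^6}^3$, the elements of $\mathcal{S}$ are the planes given by the one-dimensional $\mathbb{F}_{q^6}$-subspaces. Barlotti-Cofman representation: $\Pi_3\cong PG(3,q^6)$ has as points the points of $PG(9,q^2)\setminus\Sigma$ (affine points) and the elements of $\mathcal{S}$; its planes (hyperplanes) are $PG(\mathcal{S})$ (consisting of all elements of $\mathcal{S}$) and those represented by $6$-dimensional subspaces $S_6\not\subseteq\Sigma$ of $PG(9,q^2)$ such that $S_6\cap\Sigma$ is the $5$-dimensional span of two distinct elements of $\mathcal{S}$, the points of such a plane being the affine points of $S_6$ and the spread elements contained in $S_6$. Let $X\ne X'$ be elements of $\mathcal{S}$ and $p$ a point of $X$. Let $\Gamma$ be a $7$-dimensional subspace of $\Sigma$ with $X'\subseteq\Gamma$ and $p\notin\Gamma$. Let $\Theta=\Gamma\cap X=\langle r,\tilde{q}\rangle$ (a line) with points $r\neq\tilde{q}$ of $\Theta$, and let $\Gamma'$ be an $8$-dimensional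 subspace of $PG(9,q^2)$ with $\Gamma'\cap\Sigma=\Gamma$. For a subspace (possibly a point) $W$ and a set $A$ of points, $\mathfrak{K}(W,A)=\bigcup_{a\in A}\langle W,a\rangle$. Construction of $\bar{B}$: let $\pi$ be a plane of $\Gamma'$, not contained in $\Sigma$, through $\tilde{q}$ and a point $t\in X'$, so $\pi\cap\Sigma=\langle t,\tilde{q}\rangle$. Let $V$ be a Baer subplane (subplane of order $q$) of $\pi$ with $V\cap\langle t,\tilde{q}\rangle=\{\tilde{q}\}$. Every line of $\pi$ meets $V$ in $1$ or $q+1$ points; it is called real in the latter case. Let $L$ be a real line of $\pi$ through $t$, let $s\in V\cap L$, and put $\bar{B}=\mathfrak{K}(r,(V\setminus L)\cup\{s\})$. The point $\tilde{t}$: let $\mathfrak{R}=\{S_2\in\mathcal{S}: S_2\cap\langle t,r\rangle\neq\emptyset\}$, a regulus containing $X$ and $X'$. There is exactly one line $l$ through $p$ with $\mathfrak{R}=\{S_2\in\mathcal{S}: S_2\cap l\neq\emptyset\}$; let $\tilde{t}$ be the point $l\cap X'$ (one has $\tilde{t}\neq t$). Construction of $\tilde{B}$: let $L_1,L_2,L_3$ be lines contained in $X'$ with $L_1\cap L_2\cap L_3=\emptyset$ and $t,\tilde{t}\notin L_i$ for $i\in\{1,2,3\}$. Let $h\in\Gamma'$ be a point with $h\notin\langle X,X',V\rangle$, and put $\tilde{B}=\mathfrak{K}(h,L_1\cup L_2\cup L_3)\setminus\Sigma$. A blocking set of $\Pi_3$ is a point set of $\Pi_3$ meeting every plane of $\Pi_3$;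 it is minimal if no proper subset is a blocking set. Class MPS in $PG(3,q^6)$: write $q^6=q_1^m$ with $q_1$ a prime power and $m\geq 2$, and represent $PG(3,q_1^m)$ analogously (Barlotti-Cofman) in $PG(3m,q_1)$ with respect to a Desarguesian $(m-1)$-spread $\mathcal{S}_1$ of a hyperplane $\Sigma_1$: points are the points off $\Sigma_1$ and the elements of $\mathcal{S}_1$. Let $Y\in\mathcal{S}_1$, let $\Omega$ be a hyperplane of $Y$ (dimension $m-2$), let $\Delta'$ be a $(2m+1)$-dimensional subspace of $PG(3m,q_1)$ disjoint from $\Omega$, let $\Delta=\Delta'\cap\Sigma_1$, of dimension $2m$, and let $t_1$ be the point $\Delta\cap Y$. Let $\overline{B}_1$ be a blocking set of $\Delta'$ (a point set meeting every hyperplane of $\Delta'$) such that $\overline{B}_1\cap\Delta$ is a single point and $M\setminus\{t_1\}\not\subset\overline{B}_1$ for every line $M$ of $\Delta'$ through $t_1$. With $K_1=\mathfrak{K}(\Omega,\overline{B}_1)$, the set $(K_1\setminus\Sigma_1)\cup\{Z\in\mathcal{S}_1: Z\cap K_1\neq\emptyset\}$ is a blocking set of $PG(3,q^6)$; a blocking set of class MPS is one obtained in this way for some such choices. Two point sets are equivalent if some collineation of $PG(3,q^6)$ maps one onto the other.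
   Formalization: The point h is taken outside Σ (else B~ is empty and B is not blocking); minimality is claimed only if, for z a common point of two of the L_i and Z in S other than X, X' meeting <p,z>, t is not in <p,r,Z>: otherwise B is not minimal. *)

(* Defs.v *)
From HB Require Import structures.
From mathcomp Require Import all_boot all_order all_algebra all_field.
From mathcomp Require Import boolp classical_sets functions cardinality.

Set Implicit Arguments.
Unset Strict Implicit.
Unset Printing Implicit Defensive.

Import GRing.Theory.
Local Open Scope classical_set_scope.
Local Open Scope card_scope.
Local Open Scope ring_scope.

Definition prime_power (n : nat) : Prop :=
  exists p k : nat, [/\ prime p, (0 < k)%N & n = (p ^ k)%N].

(* The subspaces of PG(V) are the elements of {vspace V}; since [\dim] is the
   vector space dimension, a subspace of projective dimension d has
   [\dim] equal to d + 1, and incidence is (_ <= _)%VS. *)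
Section ProjectiveSpace.

Variables (F : fieldType) (V : vectType F).
Implicit Types (U W P M : {vspace V}) (A S : set {vspace V}).

Definition points U : set {vspace V} :=
  [set P | \dim P = 1%N /\ (P <= U)%VS].

Definition cone W A : set {vspace V} :=
  [set P | \dim P = 1%N /\ exists2 a, A a & (P <= W + a)%VS].

(* Point set of the subspace spanned by the members of [A]. *)
Definition joinpts A : set {vspace V} :=
  [set P | \dim P = 1%N /\ forall U, (forall W, A W -> (W <= U)%VS) -> (P <= U)%VS].

(* [M] is a line of PG(V) containing at least two points of [S]. *)
Definition secant S M : Prop :=
  \dim M = 2%N /\
  exists P P', [/\ P <> P', (S `&` points M) P & (S `&` points M) P'].

(* [S] is the point set of a subplane of order [n] of the plane [pi]. The lines
   of the subplane are the traces on [S] of the secants. *)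
Definition subplane (n : nat) (pi : {vspace V}) S : Prop :=
  [/\ S `<=` points pi,
      exists a b c d, [/\ S a, S b, S c & S d] /\
        [/\ (a + b + c)%VS = pi, (a + b + d)%VS = pi,
            (a + c + d)%VS = pi & (b + c + d)%VS = pi],
      forall M N, secant S M -> secant S N -> M <> N ->
        exists2 P, S P & (P <= M :&: N)%VS
    & forall M, secant S M -> S `&` points M #= `I_(n.+1)].

(* Line [M] of [pi] that is real with respect to a subplane of order [n]. *)
Definition real_line (n : nat) (pi : {vspace V}) S M : Prop :=
  [/\ \dim M = 2%N, (M <= pi)%VS & S `&` points M #= `I_(n.+1)].

End ProjectiveSpace.

(* A 3-dimensional projective space given by its points and planes. *)
Record geometry := Geometry {
  gcarrier : Type;
  gpoints : set gcarrier;
  gplanes : set (set gcarrier)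
}.

Definition gline (G : geometry) (l : set (gcarrier G)) : Prop :=
  exists H H', [/\ gplanes H, gplanes H', H <> H' & l = H `&` H'].

Definition collineation (G G' : geometry) (f : gcarrier G -> gcarrier G') : Prop :=
  set_bij (@gpoints G) (@gpoints G') f /\
  forall l, l `<=` @gpoints G -> (gline l <-> gline (f @` l)).

Definition equivalent (G : geometry) (B B' : set (gcarrier G)) : Prop :=
  exists2 f : gcarrier G -> gcarrier G, collineation f & f @` B = B'.

Definition blocking_set (G : geometry) (B : set (gcarrier G)) : Prop :=
  B `<=` @gpoints G /\ forall H, gplanes H -> H `&` B !=set0.

Definition minimal_blocking_set (G : geometry) (B : set (gcarrier G)) : Prop :=
  blocking_set B /\ forall C, C `<` B -> ~ blocking_set C.

(* Barlotti-Cofman representation of PG(3, L) in PG(V), where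
   \dim V = 3 * [L : F] + 1: the injective F-linear map [phi] identifies L^3
   with the hyperplane Sigma = limg phi. *)
Section BarlottiCofman.

Variables (F : fieldType) (L : fieldExtType F) (V : vectType F).
Variable phi : 'Hom({ffun 'I_3 -> L}, V).
Implicit Types (W Z M : {vspace V}).

Definition spread : set {vspace V} :=
  [set Z : {vspace V} | exists2 v : {ffun 'I_3 -> L}, v != 0 &
     forall x : V, x \in Z <-> exists a : L, x = phi [ffun i => a * v i]].

Definition affine_points : set {vspace V} :=
  [set P | \dim P = 1%N /\ ~ (P <= limg phi)%VS].

Definition BC_points : set {vspace V} := affine_points `|` spread.

Definition BC_planes : set (set {vspace V}) :=
  [set H | H = spread \/
     exists W Z Z', [/\ \dim W = (2 * \dim {:L}).+1, ~ (W <= limg phi)%VS,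
        spread Z /\ spread Z', Z <> Z' &
        (W :&: limg phi)%VS = (Z + Z')%VS] /\
        H = [set P | BC_points P /\ (P <= W)%VS]].

Definition BC : geometry := @Geometry {vspace V} BC_points BC_planes.

Definition regulus M : set {vspace V} :=
  [set Z | spread Z /\ (Z :&: M)%VS <> 0%VS].

Definition MPS_set (m : nat) (B : set {vspace V}) : Prop :=
  exists (Y Omega Delta' : {vspace V}) (B1 : set {vspace V}),
  let Delta := (Delta' :&: limg phi)%VS in
  let t1 := (Delta :&: Y)%VS in
  let K1 := cone Omega B1 in
  [/\ spread Y, (Omega <= Y)%VS & \dim Omega = m.-1] /\
  [/\ \dim Delta' = (2 * m).+2, (Delta' :&: Omega)%VS = 0%VS,
      \dim Delta = (2 * m).+1 & \dim t1 = 1%N] /\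
  [/\ B1 `<=` points Delta',
      forall U, \dim U = (2 * m).+1 -> (U <= Delta')%VS -> points U `&` B1 !=set0,
      exists P, B1 `&` points Delta = [set P]
    & forall M, \dim M = 2%N -> (M <= Delta')%VS -> (t1 <= M)%VS ->
        ~ (points M `\` [set t1] `<=` B1)] /\
  B = (K1 `\` points (limg phi)) `|`
      [set Z | spread Z /\ exists2 P, K1 P & (P <= Z)%VS].

End BarlottiCofman.

(* The blocking sets of class MPS of a model [G] of PG(3, n): the representation
   of PG(3, q1 ^ m) is carried over to [G] by an arbitrary collineation. *)
Definition class_MPS (n : nat) (G : geometry) (B : set (gcarrier G)) : Prop :=
  exists (q1 m : nat) (F1 : finFieldType) (L1 : fieldExtType F1)
         (V1 : vectType F1) (phi1 : 'Hom({ffun 'I_3 -> L1}, V1))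
         (B1 : set {vspace V1}) (f : {vspace V1} -> gcarrier G),
  [/\ prime_power q1, (2 <= m)%N & n = (q1 ^ m)%N] /\
  [/\ #|F1| = q1, \dim {:L1} = m, \dim {:V1} = (3 * m).+1 & injective phi1] /\
  [/\ MPS_set phi1 m B1, @collineation (BC phi1) G f & B = f @` B1].

(* Main.v *)
Require Import Defs.
From HB Require Import structures.
From mathcomp Require Import all_boot all_order all_algebra all_field.
From mathcomp Require Import boolp classical_sets functions cardinality.
From mathcomp Require finmap.
From mathcomp Require Import ring zify.

Set Implicit Arguments.
Unset Strict Implicit.
Unset Printing Implicit Defensive.

Import GRing.Theory.
Local Open Scope classical_set_scope.
Local Open Scope card_scope.
Local Open Scope ring_scope.

(** Affine coordinates in L^3 with origin h, in which p = (1,0,0), t = (0,1,0),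
    s = (0,0,1), r = (rho,0,0) and q~ = (tau,0,0), so that {1, rho, tau} is an
    F-basis of L, turn the cone over the Baer part into the graph
    {(u, f(ct u), 1) : u in L}: here ct is the tau-coordinate and f : F -> F is
    total because every line of pi through t other than the line at infinity
    carries exactly one of the retained points of V. The cone over the three
    lines becomes {(k, y, 0) : k in F, y in the union of three 2-dimensional
    subspaces of L}, and the planes not on X are the graphs
    a = al b + be c + ga.

    If al = 0 such a plane meets the graph, and if al <> 0 it meets the second
    part, since 1/al avoids one of the three subspaces. A tangent plane at a
    point (k0, y0, 0) exists as soon as some direction x in L moves y0 off the
    three lines and 1/x is not in <1, rho>: inversion turns a line of PG(L) into
    a conic, so at most two points of a given line are excluded.

    Non-equivalence is a counting matter. With Q = q^2 the set has
    1 + Q^3 + Q (3 Q^2 - 3 Q + 1) points, whereas a set of class MPS has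
    1 mod q1^(m-1) points, its affine part being invariant under translation by
    Omega; and q^3 divides q1^(m-1) because q1^m = q^6 and m >= 2. *)

(** * Affine coordinates *)

(** [L * L * L] is a vector space over [F] only, so scaling by [L] is spelled out coordinatewise. *)
Definition ray (L : fieldType) (v : L * L * L) (a : L) : L * L * L :=
  (a * v.1.1, a * v.1.2, a * v.2).

(* [ps] are L-linear coordinates on Sigma = limg phi, and [e0] spans the affine
   point taken as origin. *)
Record frame (F : fieldType) (L : fieldExtType F) (V : vectType F)
    (phi : 'Hom({ffun 'I_3 -> L}, V)) (ps : 'Hom((L * L * L)%type, V)) (e0 : V) : Prop :=
  Frame {
    frame_inj : lker ps = 0%VS;
    frame_limg : limg ps = limg phi;
    frame_spread : forall Z, spread phi Z <->
      exists2 v : L * L * L, v != 0 & forall x, x \in Z <->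
        exists a, x = ps (ray v a);
    frame_origin : e0 \notin limg phi;
    frame_full : (limg phi + <[e0]>)%VS = fullv
  }.

Section Frame.
Variables (F : fieldType) (L : fieldExtType F) (V : vectType F).
Variables (phi : 'Hom({ffun 'I_3 -> L}, V)) (ps : 'Hom((L * L * L)%type, V)) (e0 : V).
Hypothesis fr : frame phi ps e0.
Implicit Types (u v w : L * L * L) (U W P Z X : {vspace V}).

Definition pt v : {vspace V} := <[e0 + ps v]>%VS.

Lemma ps_inj : injective ps.
Proof. by apply/lker0P; rewrite (frame_inj fr). Qed.

Lemma ps_limg v : ps v \in limg phi.
Proof. by rewrite -(frame_limg fr) memv_img ?memvf. Qed.

Lemma limg_ps x : x \in limg phi -> exists v, x = ps v.
Proof. by rewrite -(frame_limg fr) => /memv_imgP[v _ ->]; exists v. Qed.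

(** Since [e0] lies off Sigma, a vector of Sigma has no component along it; the comparisons of
    affine points below rest on this. *)
Lemma origin_scale (k : F) x : k *: e0 + x \in limg phi -> x \in limg phi -> k = 0.
Proof.
move=> h hx; have : k *: e0 \in limg phi by rewrite -(addrK x (k *: e0)) memvB.
by rewrite rpredZeq (negPf (frame_origin fr)) orbF => /eqP.
Qed.

Lemma origin_addN v : e0 + ps v \notin limg phi.
Proof.
apply/negP=> h; have := @origin_scale 1 (ps v).
by rewrite scale1r h ps_limg => /(_ isT isT)/eqP; rewrite oner_eq0.
Qed.

Lemma pt_limg v : ~~ (pt v <= limg phi)%VS.
Proof. by rewrite -memvE origin_addN. Qed.

Lemma dim_pt v : \dim (pt v) = 1%N.
Proof.
rewrite dim_vline; case: eqP => // h; have := origin_addN v.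
by rewrite h mem0v.
Qed.

Lemma pt_affine v : affine_points phi (pt v).
Proof. by split; [exact: dim_pt | apply/negP/pt_limg]. Qed.

Lemma vline_of_dim1 P : \dim P = 1%N -> exists x, P = <[x]>%VS.
Proof.
move=> hP; exists (vpick P); apply/eqP; rewrite eq_sym eqEdim -memvE memv_pick hP dim_vline.
by rewrite vpick0 -dimv_eq0 hP.
Qed.

Lemma affineP P : affine_points phi P -> exists v, P = pt v.
Proof.
case=> /vline_of_dim1[x ->] /negP; rewrite -memvE => hx.
have : x \in (limg phi + <[e0]>)%VS by rewrite (frame_full fr) memvf.
case/memv_addP=> _ /limg_ps[v ->] [_ /vlineP[k ->] xE].
have k0 : k != 0.
  by apply: contraNneq hx => k0; rewrite xE k0 scale0r addr0 ps_limg.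
exists (k^-1 *: v); rewrite /pt; apply/eqP; rewrite eqEsubv -!memvE; apply/andP; split.
  by apply/vlineP; exists k; rewrite xE linearZ scalerDr scalerA mulfV // scale1r addrC.
by apply/vlineP; exists k^-1; rewrite xE linearZ scalerDr scalerA mulVf // scale1r addrC.
Qed.

(** Comparing components along [e0] forces the coefficient of [e0 + ps v] to be 1, so joining with a
    subspace at infinity amounts to translating by its vectors. *)
Lemma pt_le_add U w v : (U <= limg phi)%VS ->
  (pt w <= U + pt v)%VS = (ps (w - v) \in U).
Proof.
move=> hU; rewrite -memvE; apply/idP/idP=> [/memv_addP[u uU [_ /vlineP[k ->] e]]|h].
  have uS := subvP hU _ uU.
  have k1 : 1 - k = 0.
    apply: (@origin_scale _ (ps (w - k *: v))); last exact: ps_limg.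
    suff -> : (1 - k) *: e0 + ps (w - k *: v) = u by [].
    rewrite linearB linearZ /= scalerBl scale1r addrACA e -opprD -scalerDr.
    by rewrite addrK.
  have k1' : k = 1 by apply/esym/eqP; rewrite -subr_eq0 k1.
  suff -> : ps (w - v) = u by [].
  move: e; rewrite k1' scale1r linearB /= => e.
  by apply: (addIr (e0 + ps v)); rewrite -e addrC addrA addrAC addrK.
apply/memv_addP; exists (ps (w - v)) => //; exists (e0 + ps v); first exact: memv_line.
by rewrite addrCA -linearD subrK.
Qed.

Lemma pt_inj : injective pt.
Proof.
move=> v w e; apply: ps_inj; apply/eqP; rewrite -subr_eq0 -linearB.
by rewrite -memv0 -pt_le_add ?sub0v // add0v e subvv.
Qed.

Lemma pt_le_addP U v P : (U <= limg phi)%VS -> affine_points phi P ->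
  (P <= U + pt v)%VS <-> exists2 w, ps w \in U & P = pt (v + w).
Proof.
move=> hU /affineP[w ->]; rewrite pt_le_add //; split=> [h|[w' h /pt_inj ->]].
  by exists (w - v) => //; rewrite addrC subrK.
by rewrite addrAC subrr add0r.
Qed.

Lemma spread_limg Z : spread phi Z -> (Z <= limg phi)%VS.
Proof.
by case/(frame_spread fr)=> v _ hZ; apply/subvP => x /hZ[a ->]; exact: ps_limg.
Qed.

Lemma spread_scale Z a v : spread phi Z -> ps v \in Z ->
  ps (ray v a) \in Z.
Proof.
move/(frame_spread fr)=> [w _ hZ] /hZ[b /ps_inj ->]; apply/hZ; exists (a * b).
by rewrite /ray /= !mulrA.
Qed.

Lemma spread_ptN Z v : spread phi Z -> Z <> pt v.
Proof. by move=> /spread_limg h e; move: (pt_limg v); rewrite -e h. Qed.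

Lemma ray_linear v : linear (fun a : L => ps (ray v a)).
Proof. by move=> k a b; rewrite -linearP; congr (ps (_, _, _)); rewrite /= mulrDl -scalerAl. Qed.

Definition ray_lin v : {linear L -> V} :=
  HB.pack (fun a : L => ps (ray v a)) (@GRing.isLinear.Build F L V _ _ (ray_linear v)).

Lemma mem_ray v x : x \in limg (linfun (ray_lin v)) <-> exists a, x = ps (ray v a).
Proof.
split=> [/memv_imgP[a _ ->]|[a ->]]; first by exists a; rewrite lfunE.
by apply/memv_imgP; exists a; rewrite ?memvf // lfunE.
Qed.

Lemma spread_exists v : v != 0 -> exists Z, spread phi Z /\
  forall x, x \in Z <-> exists a, x = ps (ray v a).
Proof.
move=> v0; exists (limg (linfun (ray_lin v))); split; last exact: mem_ray.
by apply/(frame_spread fr); exists v => // x; exact: mem_ray.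
Qed.

Lemma dim_spread Z : spread phi Z -> \dim Z = \dim {:L}.
Proof.
case/(frame_spread fr)=> v v0 hZ.
have -> : Z = limg (linfun (ray_lin v)).
  by apply/vspaceP=> x; apply/idP/idP=> [/hZ/mem_ray|/mem_ray/hZ].
rewrite limg_dim_eq // (_ : lker _ = 0%VS) ?capv0 //; apply/eqP/lker0P => a b.
rewrite !lfunE /= => /ps_inj [h1 h2 h3]; apply/eqP; rewrite -subr_eq0.
have /eqP: (v.1.1, v.1.2, v.2) != 0 by case: (v) v0 => [[]].
apply: contra_notT => ab; rewrite -[0]/((0, 0, 0)).
by congr (_, _, _); apply/(mulfI ab); rewrite mulr0 mulrBl ?h1 ?h2 ?h3 subrr.
Qed.

(** A nonzero common vector is a nonzero [L]-multiple of either generator, so it generates both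
    elements over [L]. *)
Lemma spread_meet Z Z' x : spread phi Z -> spread phi Z' -> x != 0 -> x \in Z -> x \in Z' -> Z = Z'.
Proof.
move=> sZ sZ' x0 xZ xZ'.
have sub Z1 Z2 : spread phi Z1 -> spread phi Z2 -> x \in Z1 -> x \in Z2 -> (Z1 <= Z2)%VS.
  move=> /(frame_spread fr)[v v0 hv] s2 /hv[a xE] x2; apply/subvP=> y /hv[b ->].
  have a0 : a != 0.
    apply: contraNneq x0 => a0; rewrite xE a0 /ray !mul0r.
    by apply/eqP; exact: (linear0 ps).
  have -> : ray v b = ray (ray v a) (b / a).
    by rewrite /ray /= !mulrA divfK.
  by apply: spread_scale => //; rewrite -xE.
by apply/eqP; rewrite eqEsubv !sub.
Qed.

Lemma spread_through x : x \in limg phi -> x != 0 -> exists2 Z, spread phi Z & x \in Z.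
Proof.
move=> /limg_ps[v xE] x0.
have v0 : v != 0 by apply: contraNneq x0 => v0; rewrite xE v0 linear0.
have [Z [sZ hZ]] := spread_exists v0; exists Z => //; apply/hZ; exists 1.
by rewrite xE /ray !mul1r; case: (v) => [[]].
Qed.

End Frame.

(** * Equations of the planes that do not contain the point X *)

Section Planes.
Variables (F : fieldType) (L : fieldExtType F) (V : vectType F).
Variables (phi : 'Hom({ffun 'I_3 -> L}, V)) (ps : 'Hom((L * L * L)%type, V)) (e0 : V).
Hypothesis fr : frame phi ps e0.
Implicit Types (u v w : L * L * L) (U W P Z X : {vspace V}).
Notation pt := (pt ps e0).

Lemma dim_limg : \dim (limg phi) = (3 * \dim {:L})%N.
Proof.
rewrite -(frame_limg fr) limg_dim_eq ?(frame_inj fr) ?capv0 // !dimvf /dim /=.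
by rewrite !mulSn addn0 addnA.
Qed.

Lemma dim_full : \dim {:V} = (3 * \dim {:L}).+1.
Proof.
rewrite -(frame_full fr) dimv_disjoint_sum ?dim_limg ?dim_vline.
  case: eqP (frame_origin fr) => [->|]; rewrite ?mem0v //= addn1 //.
apply/eqP; rewrite -subv0; apply/subvP=> x /memv_capP[hx /vlineP[k xE]].
have := @origin_scale _ _ _ _ _ _ fr k 0; rewrite addr0 -xE hx mem0v.
by move=> /(_ isT isT) k0; rewrite xE k0 scale0r mem0v.
Qed.

Variable X : {vspace V}.
Hypothesis hX : forall x, x \in X <-> exists a, x = ps (a, 0, 0).

Lemma spread_X : spread phi X.
Proof.
apply/(frame_spread fr); exists (1, 0, 0) => [|x /=].
  by apply/eqP=> -[/eqP]; rewrite oner_eq0.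
by split=> [/hX[a ->]|[a ->]]; [exists a|apply/hX; exists a]; rewrite /ray /= mulr1 !mulr0.
Qed.

(** The part [T] of the plane at infinity is closed under [L] and complementary to X, so every
    vector of Sigma is congruent modulo [T] to some (a, 0, 0). Reducing (0, 1, 0), (0, 0, 1) and one
    affine point in this way yields the three coefficients. *)
Lemma plane_equation H : BC_planes phi H -> ~ H X ->
  exists al be ga, forall b c, H (pt (al * b + be * c + ga, b, c)).
Proof.
case=> [-> /(_ spread_X)//|[W [Z [Z' [[dW WS [sZ sZ'] ZZ' WE] ->]]]] HX].
have XW : ~~ (X <= W)%VS.
  by apply: contra_notN HX => XW; split=> //; right; exact: spread_X.
pose T := (Z + Z')%VS.
have TS : (T <= limg phi)%VS by rewrite subv_add !(spread_limg fr).
(* Both summands of [T] are spread elements, so [T] is closed under [L] and not only under [F]. *)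
have Tscale a v : ps v \in T -> ps (ray v a) \in T.
  case/memv_addP=> z zZ [z' zZ' e].
  have [w zE] := limg_ps fr (subvP (spread_limg fr sZ) _ zZ).
  have [w' zE'] := limg_ps fr (subvP (spread_limg fr sZ') _ zZ').
  move: e; rewrite zE zE' -linearD => /(ps_inj fr) ->.
  rewrite (_ : ray _ a = ray w a + ray w' a); last by rewrite /ray /= !mulrDr.
  by rewrite linearD memv_add // (spread_scale fr) -?zE -?zE'.
have XT0 : (X :&: T = 0)%VS.
  apply/eqP; rewrite -subv0; apply/subvP=> x /memv_capP[/hX[a ->] aT].
  rewrite memv0; apply: contraNT XW => a0; apply/subvP=> y /hX[b ->].
  have an0 : a != 0.
    by apply: contraNneq a0 => ->; rewrite [X in ps X](_ : _ = 0) ?linear0.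
  have := Tscale (b / a) _ aT; rewrite /ray /= !mulr0 divfK // /T -WE.
  by rewrite memv_cap => /andP[].
have [x0 x0W x0S] : exists2 x, x \in W & x \notin limg phi.
  by apply: contra_notP WS => h; apply/subvP => x xW; apply: contra_notT h => xS; exists x.
have [g gW] : exists g, e0 + ps g \in W.
  have : x0 \in (limg phi + <[e0]>)%VS by rewrite (frame_full fr) memvf.
  case/memv_addP=> _ /(limg_ps fr)[v ->] [_ /vlineP[k ->] xE].
  have k0 : k != 0.
    by apply: contraNneq x0S => k0; rewrite xE k0 scale0r addr0 (ps_limg fr).
  exists (k^-1 *: v); rewrite linearZ /=.
  have -> : e0 + k^-1 *: ps v = k^-1 *: x0; last exact: memvZ.
  by rewrite xE scalerDr scalerA mulVf // scale1r addrC.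
have dT : (2 * \dim {:L} <= \dim T)%N.
  have : \dim (W + limg phi) = (3 * \dim {:L}).+1.
    apply/eqP; rewrite eqn_leq -{1}dim_full dimvS ?subvf //= -dim_limg ltnNge.
    apply/negP=> h; have /eqP : (limg phi == W + limg phi)%VS.
      by rewrite eqEdim addvSr.
    by move=> e; case: WS; rewrite e addvSl.
  have := dimv_sum_cap W (limg phi).
  rewrite WE -/T => E1 E2; move: E1; rewrite E2 dW dim_limg; lia.
have XTE : (X + T = limg phi)%VS.
  apply/eqP; rewrite eqEdim subv_add TS (spread_limg fr spread_X) /=.
  by rewrite dimv_disjoint_sum // (dim_spread fr spread_X) dim_limg; lia.
have corr v : exists a, ps (v - (a, 0, 0)) \in T.
  have : ps v \in (X + T)%VS by rewrite XTE (ps_limg fr).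
  case/memv_addP=> _ /hX[a ->] [y yT e]; exists a.
  by rewrite linearB /= e addrC addKr.
have [al al1] := corr (0, 1, 0).
have [be be1] := corr (0, 0, 1).
have [a gE] : exists a, ps (g - (a, 0, 0)) \in T by exact: corr.
(* The signs reflect that [corr] puts (-al, 1, 0) and (-be, 0, 1) in [T]. *)
exists (- al), (- be), a => b c; split; first by left; exact: pt_affine.
rewrite -memvE.
pose v1 : L * L * L := (0, 1, 0) - (al, 0, 0).
pose v2 : L * L * L := (0, 0, 1) - (be, 0, 0).
have -> : (- al * b + - be * c + a, b, c) = g - (g - (a, 0, 0)) + (ray v1 b + ray v2 c).
  by case: (g) => [[g1 g2] g3]; congr (_, _, _); rewrite /=; ring.
have TW : (T <= W)%VS by rewrite /T -WE capvSl.
rewrite linearD linearB addrA addrA memvD // ?memvB //.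
  by apply: (subvP TW); exact: gE.
by apply: (subvP TW); rewrite linearD memvD ?Tscale.
Qed.

(** The plane is spanned by the spread elements through (al, 1, 0) and (be, 0, 1) and the affine
    point (ga, 0, 0). It serves to build tangent planes with prescribed coefficients. *)
Lemma plane_exists al be ga : exists H, [/\ BC_planes phi H, ~ H X &
  forall v, H (pt v) -> v.1.1 = al * v.1.2 + be * v.2 + ga].
Proof.
have n1 : (al, 1, 0) != 0 :> L * L * L by apply/eqP=> -[_ /eqP]; rewrite oner_eq0.
have n2 : (be, 0, 1) != 0 :> L * L * L by apply/eqP=> -[_ /eqP]; rewrite oner_eq0.
have [Z [sZ hZ]] := spread_exists fr n1.
have [Z' [sZ' hZ']] := spread_exists fr n2.
pose T := (Z + Z')%VS; pose W := (T + pt (ga, 0, 0)%R)%VS.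
have TS : (T <= limg phi)%VS by rewrite subv_add !(spread_limg fr).
have TE v : ps v \in T -> v.1.1 = al * v.1.2 + be * v.2.
  case/memv_addP=> _ /hZ[a ->] [_ /hZ'[b ->]]; rewrite -linearD => /(ps_inj fr) -> /=.
  by ring.
have ZZ' : (Z :&: Z' = 0)%VS.
  apply/eqP; rewrite -subv0; apply/subvP=> x /memv_capP[/hZ[a ->] /hZ'[b]].
  move=> /(ps_inj fr) [_]; rewrite /= mulr1 mulr0 => a0 _.
  by rewrite a0 /ray !mul0r [X in ps X](_ : _ = 0) ?linear0 ?mem0v.
have WT : (W :&: limg phi = T)%VS.
  apply/eqP; rewrite eqEsubv subv_cap addvSl TS !andbT; apply/subvP=> x.
  case/memv_capP=> /memv_addP[y yT [_ /vlineP[k ->] ->]] h.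
  suff -> : k = 0 by rewrite scale0r addr0.
  apply: (@origin_scale _ _ _ _ _ _ fr k (k *: ps (ga, 0, 0) + y)).
    by rewrite addrA -scalerDr addrC.
  by rewrite memvD ?memvZ ?(ps_limg fr) // (subvP TS).
have WE : BC_planes phi [set P | BC_points phi P /\ (P <= W)%VS].
  right; exists W, Z, Z'; split=> //; split=> //.
  - rewrite dimv_disjoint_sum.
      by rewrite dimv_disjoint_sum // (dim_spread fr sZ) (dim_spread fr sZ') (dim_pt fr); lia.
    apply/eqP; rewrite -subv0; apply/subvP=> x /memv_capP[xT /vlineP[k xE]].
    have k0 : k = 0.
      apply: (@origin_scale _ _ _ _ _ _ fr k (k *: ps (ga, 0, 0))).
        by rewrite -scalerDr -xE (subvP TS).
      by rewrite memvZ ?(ps_limg fr).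
    by rewrite xE k0 scale0r mem0v.
  - move=> h; move: (pt_limg fr (ga, 0, 0)).
    by rewrite (subv_trans _ h) ?addvSr.
  - move=> e; have := dim_spread fr sZ; rewrite -[Z]capvv {2}e ZZ' dimv0.
    move/eqP; rewrite eq_sym dimv_eq0 -subv0 => /subvP/(_ 1).
    by rewrite memvf memv0 oner_eq0 => /(_ isT).
exists [set P | BC_points phi P /\ (P <= W)%VS]; split=> //.
  case=> _ /subvP XW.
  have : ps (1, 0, 0) \in T.
    by rewrite -WT memv_cap (ps_limg fr) XW //; apply/hX; exists 1.
  by move=> /TE /=; rewrite !mulr0 addr0 => /eqP; rewrite oner_eq0.
by move=> v [_]; rewrite (pt_le_add fr) // => /TE /= e; rewrite -[v.1.1](subrK ga) e !subr0.
Qed.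

End Planes.

(** * Inversion in a cubic extension *)

Section CubicExtension.
Variables (F : fieldType) (L : fieldExtType F).
Hypothesis hL : \dim {:L} = 3%N.

(** The degree of theta over [F] divides the prime 3 and is not 1, so its minimal polynomial has
    degree 3 and divides no nonzero polynomial of degree at most 2. *)
Lemma cubic_root (theta : L) (p : {poly F}) : theta \notin 1%VS -> (size p <= 3)%N ->
  root (map_poly (in_alg L) p) theta -> p = 0.
Proof.
move=> h1 sp rp; set P := map_poly _ p in rp.
have sP : size P = size p by rewrite size_map_poly.
have PO : P \is a polyOver 1%VS.
  by apply/polyOverP=> i; rewrite coef_map /= memvZ ?mem1v.
have [deg|deg] : adjoin_degree 1%AS theta = 1%N \/ adjoin_degree 1%AS theta = 3%N.
  have : (adjoin_degree 1%AS theta %| 3)%N.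
    have := dim_Fadjoin 1%AS theta; rewrite dimv1 muln1 -hL => <-.
    by apply: field_dimS; exact: subvf.
  rewrite (dvdn_divisors _ (isT : 0 < 3)%N) !inE => /orP[/eqP->|/eqP->]; [by left|by right].
- by case/negP: h1; rewrite -adjoin_deg_eq1 deg.
have : minPoly 1%AS theta %| P by apply: minPoly_dvdp.
move=> /dvdp_leq => dv; apply/eqP; apply: contraT => p0.
have P0 : P != 0 by rewrite map_poly_eq0.
by have := dv P0; rewrite size_minPoly deg sP => h; move: (leq_trans h sp).
Qed.

(** Clearing denominators gives a polynomial of degree at most 2 that vanishes at theta, hence is
    zero; its values at [- c1], [- c2] and [- c3] isolate the three coefficients. *)
Lemma inverses_free (theta : L) (c1 c2 c3 d1 d2 d3 : F) : theta \notin 1%VS ->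
  [/\ c1 != c2, c1 != c3 & c2 != c3] ->
  d1 *: (theta + c1%:A)^-1 + d2 *: (theta + c2%:A)^-1 + d3 *: (theta + c3%:A)^-1 = 0 ->
  [/\ d1 = 0, d2 = 0 & d3 = 0].
Proof.
move=> h1 [n12 n13 n23] e.
have nz c : theta + c%:A != 0.
  apply: contraNneq h1 => /eqP; rewrite addr_eq0 => /eqP->.
  by rewrite memvN memvZ // mem1v.
pose l c : {poly F} := 'X + c%:P.
pose p := d1 *: (l c2 * l c3) + d2 *: (l c1 * l c3) + d3 *: (l c1 * l c2).
have sl c c' d : (size (d *: (l c * l c')) <= 3)%N.
  rewrite (leq_trans (size_scale_leq _ _)) // (leq_trans (size_polyMleq _ _)) //.
  by rewrite !size_XaddC.
have p0 : p = 0.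
  apply: (cubic_root h1).
    by rewrite !(leq_trans (size_polyD _ _)) // geq_max ?sl //
      !(leq_trans (size_polyD _ _)) // geq_max ?sl.
  rewrite /root /p !rmorphD /= !linearZ /= !rmorphM /= /l !rmorphD /= !map_polyX !map_polyC /=.
  rewrite !hornerE /=.
  have := nz c1; have := nz c2; have := nz c3; move: e.
  have sc (d : F) (x : L) : d *: x = d%:A * x by rewrite mulr_algl.
  rewrite (sc d1 (_ + _)^-1) (sc d2 (_ + _)^-1) (sc d3 (_ + _)^-1).
  move: (theta + c1%:A) (theta + c2%:A) (theta + c3%:A) => x1 x2 x3 e z3 z2 z1.
  have : (d1%:A * x1^-1 + d2%:A * x2^-1 + d3%:A * x3^-1) * (x1 * x2 * x3) = 0 by rewrite e mul0r.
  by move=> <-; apply/eqP; field; rewrite z1 z2 z3.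
have ev x : d1 * ((x + c2) * (x + c3)) + d2 * ((x + c1) * (x + c3)) + d3 * ((x + c1) * (x + c2)) = 0.
  have : p.[x] = 0 by rewrite p0 horner0.
  by rewrite /p /l !(hornerD, hornerZ, hornerM, hornerX, hornerC).
have nn (d a b c : F) : a != b -> a != c -> d * ((- a + b) * (- a + c)) = 0 -> d = 0.
  move=> ab ac /eqP; rewrite !mulf_eq0 ![- a + _]addrC !subr_eq0.
  by rewrite ![_ == a]eq_sym (negPf ab) (negPf ac) !orbF => /eqP.
have [n21 n31 n32] : [/\ c2 != c1, c3 != c1 & c3 != c2] by rewrite ![c3 == _]eq_sym eq_sym.
split.
- by apply: (nn d1 c1 c2 c3) => //; rewrite -(ev (- c1)); ring.
- by apply: (nn d2 c2 c1 c3) => //; rewrite -(ev (- c2)); ring.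
- by apply: (nn d3 c3 c1 c2) => //; rewrite -(ev (- c3)); ring.
Qed.

(* Inversion maps a line of PG(L) to a conic, which meets a line in at most two points. *)
Lemma inverse_meets_line (U : {vspace L}) (u w : L) (c1 c2 c3 : F) : (\dim U <= 2)%N ->
  w != 0 -> u / w \notin 1%VS -> [/\ c1 != c2, c1 != c3 & c2 != c3] ->
  [/\ (u + c1 *: w)^-1 \in U, (u + c2 *: w)^-1 \in U & (u + c3 *: w)^-1 \in U] -> False.
Proof.
move=> dU w0 uw cc [h1 h2 h3].
pose s := [tuple (u + c1 *: w)^-1; (u + c2 *: w)^-1; (u + c3 *: w)^-1].
suff fs : free s.
  have : (<<s>> <= U)%VS by apply/span_subvP => x; rewrite !inE => /or3P[]/eqP->.
  by move/dimvS; rewrite (eqP fs) /= => h; have := leq_trans h dU.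
have E c : (u + c *: w)^-1 = w^-1 * (u / w + c%:A)^-1.
  by rewrite -invfM mulrDr mulrCA divff // mulr1 -scalerAr mulr1.
apply/freeP => k; rewrite !big_ord_recl big_ord0 /=.
rewrite !E addr0 !scalerAr -!mulrDr addrA => /eqP; rewrite mulf_eq0 invr_eq0 (negPf w0) /=.
move=> /eqP/(inverses_free uw cc)[k1 k2 k3] [[|[|[|//]]] i3].
- by rewrite (_ : Ordinal _ = ord0) //; exact: val_inj.
- by rewrite (_ : Ordinal _ = lift ord0 ord0) //; exact: val_inj.
- by rewrite (_ : Ordinal _ = lift ord0 (lift ord0 ord0)) //; exact: val_inj.
Qed.
End CubicExtension.

(** A field with more than three elements has three distinct nonzero scalars, and by
    [inverse_meets_line] they cannot all fail. *)
Lemma inverse_avoids_line (F : finFieldType) (L : fieldExtType F) (U : {vspace L}) (u w : L) :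
  (3 < #|F|)%N -> \dim {:L} = 3%N -> (\dim U <= 2)%N -> w != 0 -> u / w \notin 1%VS ->
  exists2 c : F, c != 0 & (u + c *: w)^-1 \notin U.
Proof.
move=> cF hL dU w0 uw.
have [c1 [c2 [c3 [cc [z1 z2 z3]]]]] : exists c1 c2 c3 : F,
    [/\ c1 != c2, c1 != c3 & c2 != c3] /\ [/\ c1 != 0, c2 != 0 & c3 != 0].
  have : (2 < #|[set~ (0%R : F)]%SET|)%N by rewrite cardsC1 -ltnS prednK // (ltn_trans _ cF).
  case/card_gt2P=> c1 [c2 [c3 [[+ + +] [n12 n23 n31]]]]; rewrite !inE => z1 z2 z3.
  by exists c1, c2, c3; split=> //; split=> //; rewrite eq_sym.
have [b1|b1] := boolP ((u + c1 *: w)^-1 \in U); last by exists c1.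
have [b2|b2] := boolP ((u + c2 *: w)^-1 \in U); last by exists c2.
have [b3|b3] := boolP ((u + c3 *: w)^-1 \in U); last by exists c3.
by case: (inverse_meets_line hL dU w0 uw cc).
Qed.

(** * Graph cones *)

(** A proper subset misses some point, and the plane tangent there then misses the whole subset. *)
Lemma minimal_of_tangent_planes (G : geometry) (B : set (gcarrier G)) :
  @blocking_set G B ->
  (forall P, B P -> exists2 H, @gplanes G H & forall Q, H Q -> B Q -> Q = P) ->
  @minimal_blocking_set G B.
Proof.
move=> bB tg; split=> // C [CB BC] [_ bC]; apply: BC => P BP.
have [H pH HP] := tg P BP; have [Q [HQ CQ]] := bC H pH.
by rewrite -(HP Q HQ (CB _ CQ)).
Qed.

Lemma ord3_split (i : 'I_3) : exists j k, [/\ i != j, i != k, j != k &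
  forall m, [\/ m = i, m = j | m = k]].
Proof.
have ex (m : 'I_3) : [\/ m = ord0, m = lift ord0 ord0 | m = lift ord0 (lift ord0 ord0)].
  by case: m => [[|[|[|//]]] hm]; [apply: Or31|apply: Or32|apply: Or33]; apply: val_inj.
case: (ex i) => ->; [exists (lift ord0 ord0), (lift ord0 (lift ord0 ord0))
  | exists ord0, (lift ord0 (lift ord0 ord0)) | exists ord0, (lift ord0 ord0)];
  split=> // m; case: (ex m) => ->; by [apply: Or31|apply: Or32|apply: Or33].
Qed.

(** * Directions that leave a triangle of lines in PG(L) *)

Section Triangle.
Variables (F : finFieldType) (L : fieldExtType F) (Lam : 'I_3 -> {vspace L}).
Hypothesis hL : \dim {:L} = 3%N.
Hypotheses (dLam : forall i, \dim (Lam i) = 2%N)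
  (Lam0 : forall y, (forall i, y \in Lam i) -> y = 0).

(** Two lines of the projective plane PG(L) meet, and a third line through their intersection would
    contradict [Lam0]. *)
Lemma vertex i j : i != j -> exists z, [/\ z != 0, z \in Lam i, z \in Lam j &
  forall k, i != k -> j != k -> z \notin Lam k].
Proof.
move=> ij; pose W := (Lam i :&: Lam j)%VS; exists (vpick W).
have d0 : (0 < \dim W)%N.
  have := dimv_sum_cap (Lam i) (Lam j); rewrite !dLam -/W => e.
  by have := dimvS (subvf (Lam i + Lam j)); rewrite hL; lia.
have z0 : vpick W != 0 by rewrite vpick0 -dimv_eq0 -lt0n.
have /memv_capP[zi zj] := memv_pick W.
split=> // k ik jk; apply: contraNN z0 => zk; apply/eqP/Lam0 => m.
have [a [b [ia ib ab all]]] := ord3_split i.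
have : m = i \/ m = j \/ m = k.
  move: ij ik jk; case: (all m) => ->; case: (all j) => ->; case: (all k) => ->;
  rewrite ?eqxx //; by [left|right; left|right; right].
by case=> [->|[->|->]].
Qed.

Variable U : {vspace L}.
Hypotheses (cF : (3 < #|F|)%N) (dU : (\dim U <= 2)%N).
Hypothesis generic : forall i j y, i != j -> y != 0 -> y \in Lam i -> y \in Lam j ->
  y^-1 \notin U.

(** A subspace containing [y0] is left at once if it does not contain [x], and a subspace missing
    [y0] is never reached if it contains [x]. The choice of [x] thus depends on whether three, two
    or one of the subspaces contain [y0]. *)
Lemma triangle_escape i y0 : y0 \in Lam i -> exists x, [/\ x != 0, x^-1 \notin U &
  forall j k, y0 + k *: x \in Lam j -> k = 0].
Proof.
move=> y0i.
have scale (m : 'I_3) (a : F) z : z \notin Lam m -> a *: z \in Lam m -> a = 0.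
  by move=> zm; rewrite rpredZeq (negPf zm) orbF => /eqP.
have indep (u w : L) (m : 'I_3) : u != 0 -> u \in Lam m -> w \notin Lam m ->
    w != 0 /\ u / w \notin 1%VS.
  move=> u0 um wm; have w0 : w != 0 by apply: contraNneq wm => ->; exact: mem0v.
  split=> //; apply: contraNN u0 => /vlineP[a e].
  have uE : u = a *: w by rewrite -(divfK w0 u) e mulr_algl.
  by rewrite uE; rewrite uE in um; rewrite (scale _ _ _ wm um) scale0r.
have nz (x : L) (m : 'I_3) : x \notin Lam m -> x != 0.
  by apply: contraNneq => ->; exact: mem0v.
(* For [y0 = 0] the direction has to avoid all three sides. With the vertices [u], [v], [w], the
   vector [u + c *: (v + w)] is congruent to c(v + w), cv and u modulo the sides i, j and k. *)
have [y00|y00] := eqVneq y0 0.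
  have [j [k [ij ik jk all]]] := ord3_split i.
  have [u [u0 ui uj uk]] := vertex ij.
  have [v [v0 vi vk vj]] := vertex ik.
  have [w [w0 wj wk wi]] := vertex jk.
  have {}uk := uk k ik jk; have {vj} vj := vj j ij; rewrite eq_sym jk in vj; have {}vj := vj isT.
  have {wi} wi := wi i; rewrite ![_ == i]eq_sym ij ik in wi; have {}wi := wi isT isT.
  have vwi : v + w \notin Lam i by rewrite rpredDl.
  have [vw0 uvw] := indep _ _ _ u0 ui vwi.
  have [c c0 cU] := inverse_avoids_line cF hL dU vw0 uvw.
  have ni m : u + c *: (v + w) \notin Lam m.
    apply: contra_neqN c0 => h; case: (all m) h => -> h.
    - by apply: (scale i c _ vwi); move: h; rewrite rpredDl.
    - apply: (scale j c v vj).
      have wcj : c *: w \in Lam j by rewrite memvZ.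
      by move: h; rewrite rpredDl // scalerDr rpredDr.
    - case/negP: uk; move: h; rewrite rpredDr ?memvZ ?rpredD //.
  exists (u + c *: (v + w)); split=> //; first exact: nz (ni i).
  by move=> m a; rewrite y00 add0r; exact: scale.
(* If [y0] is a nonzero multiple of the vertex on the sides i and j, take [x] on the third side, off
   its two vertices; the scalar [c] keeps 1/x out of [U]. *)
have [[j ij y0j]|yother] : (exists2 j, i != j & y0 \in Lam j) \/ (forall j, i != j -> y0 \notin Lam j).
  have [/existsP[j /andP[ij yj]]|/existsPn h] := boolP [exists j, (i != j) && (y0 \in Lam j)].
    by left; exists j.
  by right=> j ij; have := h j; rewrite ij.
  have [k [ik jk all]] : exists k, [/\ i != k, j != k & forall m, [\/ m = i, m = j | m = k]].
    have [a [b [ia ib ab all]]] := ord3_split i.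
    case: (all j) => e; first by rewrite e eqxx in ij.
      by exists b; rewrite e.
    exists a; rewrite e [b == a]eq_sym ia; split=> // m.
    by case: (all m) => ->; [apply: Or31|apply: Or33|apply: Or32].
  have [u [u0 ui uk uj]] := vertex ik.
  have [w [w0 wj wk wi]] := vertex jk.
  have {uj} uj := uj j ij; rewrite eq_sym jk in uj; have {}uj := uj isT.
  have {wi} wi := wi i; rewrite ![_ == i]eq_sym ij ik in wi; have {}wi := wi isT isT.
  have y0k : y0 \notin Lam k.
    by apply: contra_neqN y00 => h; apply: Lam0 => m; case: (all m) => ->.
  have [_ uw] := indep _ _ _ u0 ui wi.
  have [c c0 cU] := inverse_avoids_line cF hL dU w0 uw.
  have xi : u + c *: w \notin Lam i.
    by rewrite rpredDl //; apply: contraNN c0 => h; apply/eqP/(scale _ _ _ wi h).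
  have xj : u + c *: w \notin Lam j by rewrite rpredDr // memvZ.
  exists (u + c *: w); split=> //; first exact: nz xi.
  move=> m a; case: (all m) => ->.
  - by rewrite rpredDl //; exact: scale.
  - by rewrite rpredDl //; exact: scale.
  - by rewrite rpredDr ?(negPf y0k) // memvZ // rpredD // memvZ.
(* If [y0] lies on the side i only, the vertex of the other two sides is taken as direction;
   [generic] enters here. *)
have [j [k [ij ik jk all]]] := ord3_split i.
have [x [x0 xj xk xi]] := vertex jk.
have {xi} xi := xi i; rewrite ![_ == i]eq_sym ij ik in xi; have {}xi := xi isT isT.
exists x; split=> //; first exact: (generic jk).
move=> m a; case: (all m) => ->.
- by rewrite rpredDl //; exact: scale.
- by rewrite rpredDr ?(negPf (yother _ ij)) // memvZ.
- by rewrite rpredDr ?(negPf (yother _ ik)) // memvZ.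
Qed.
End Triangle.

(** * Blocking property and tangent planes of the graph cone *)

Section NormalForm.
Variables (F : finFieldType) (L : fieldExtType F) (V : vectType F).
Variables (phi : 'Hom({ffun 'I_3 -> L}, V)) (ps : 'Hom((L * L * L)%type, V)) (e0 : V).
Hypothesis fr : frame phi ps e0.
Hypotheses (cF : (3 < #|F|)%N) (hL : \dim {:L} = 3%N).
Notation pt := (pt ps e0).
Variables (X : {vspace V}) (ct : L -> F) (f : F -> F) (Lam : 'I_3 -> {vspace L}).

Definition graph_cone : set {vspace V} :=
  [set P | [\/ P = X, exists u, P = pt (u, (f (ct u))%:A, 1)
     | exists k i y, y \in Lam i /\ P = pt (k%:A, y, 0)]].

Hypothesis hX : forall x, x \in X <-> exists a, x = ps (a, 0, 0).
Hypotheses (dLam : forall i, \dim (Lam i) = 2%N)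
  (Lam0 : forall y, (forall i, y \in Lam i) -> y = 0).

Lemma graph_cone_blocking : @blocking_set (BC phi) graph_cone.
Proof.
split=> [P [->|[u ->]|[k [i [y [_ ->]]]]]|H pH].
- by right; exact: (spread_X fr hX).
- by left; exact: (pt_affine fr).
- by left; exact: (pt_affine fr).
have [HX|HX] := pselect (H X); first by exists X; split=> //; apply: Or31.
have [al [be [ga HP]]] := plane_equation fr hX pH HX.
(* For [al = 0] the first coordinate on the plane at c = 1 is be + ga whatever the second one is, so
   the graph supplies a point. *)
have [al0|al0] := eqVneq al 0.
  exists (pt (be + ga, (f (ct (be + ga)))%:A, 1)); split; last by apply: Or32; exists (be + ga).
  by have := HP (f (ct (be + ga)))%:A 1; rewrite al0 mul0r add0r mulr1.
have [i ni] : exists i, al^-1 \notin Lam i.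
  apply: contra_neqP al0 => h; apply: invr_inj; rewrite invr0; apply: Lam0 => i.
  by apply: contra_notT h => hi; exists i.
have full : (<[al^-1]> + Lam i)%VS = fullv.
  apply/eqP; rewrite eqEdim subvf /= hL dimv_disjoint_sum ?dLam ?dim_vline ?invr_eq0 ?al0 //.
  apply/eqP; rewrite -subv0; apply/subvP=> x /memv_capP[/vlineP[k ->]].
  by rewrite rpredZeq (negPf ni) orbF => /eqP ->; rewrite scale0r mem0v.
(* Writing -ga/al as k/al + y with [y] on the line makes al y + ga equal to the scalar -k. *)
have : - (al^-1 * ga) \in (<[al^-1]> + Lam i)%VS by rewrite full memvf.
case/memv_addP=> _ /vlineP[k ->] [y yi e].
exists (pt ((- k)%:A, y, 0)); split; last by apply: Or33; exists (- k), i, y.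
suff <- : al * y + be * 0 + ga = (- k)%:A by exact: HP.
have -> : y = - (al^-1 * ga) - k *: al^-1 by rewrite e addrC addKr.
rewrite mulr0 addr0 mulrBr mulrN mulrA divff // mul1r addrAC addNr add0r.
by rewrite -scalerAr divff // scaleNr.
Qed.

Variables (U : {vspace L}) (tau rho : L).
Hypotheses (dU : (\dim U <= 2)%N) (ker_ct : forall u, (u \in U) = (ct u == 0))
  (ctD : forall a b, ct (a + b) = ct a + ct b)
  (ctZ : forall (k : F) a, ct (k *: a) = k * ct a) (ct_tau : ct tau = 1) (rhoF : rho \notin 1%VS).
Hypothesis generic : forall i j y, i != j -> y != 0 -> y \in Lam i -> y \in Lam j ->
  y^-1 \notin U.
Variables A C : F.
Hypotheses (A0 : A != 0) (fA : forall l, l != A * f l + C).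

Lemma graph_cone_minimal : @minimal_blocking_set (BC phi) graph_cone.
Proof.
apply: minimal_of_tangent_planes; first exact: graph_cone_blocking.
move=> P [->|[u ->]|[k0 [i [y0 [y0i ->]]]]].
- exists (spread phi) => [|Q sQ]; first by left.
  by case=> [//|[u e]|[k [i [y [_ e]]]]]; case: (spread_ptN fr sQ e).
(* At c = 1 this plane has first coordinate u only; at c = 0 it has first coordinate rho, which is
   not in [F]. *)
- have [H [pH HX HE]] := plane_exists fr hX 0 (u - rho) rho.
  exists H => // Q + BQ; case: BQ => [->//|[u' -> /HE]|[k [i [y [yi ->]]]] /HE] /=.
    by rewrite mul0r add0r mulr1 subrK => ->.
  by rewrite mul0r mulr0 !add0r => e; case/negP: rhoF; rewrite -e memvZ // mem1v.
have [x [x0 xU xesc]] := triangle_escape hL dLam Lam0 cF dU generic y0i.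
have ctx : ct x^-1 != 0 by rewrite -ker_ct.
(* The plane passes through (k0, y0, 0), and al and be + ga have images A and C under [ct]. Applying
   [ct] to its equation at a point of the graph gives l = A f(l) + C for l = [ct u], against
   [fA]. *)
pose al := (A / ct x^-1) *: x^-1; pose ga := k0%:A - al * y0.
pose be := C *: tau - ga.
have al0 : al != 0 by rewrite scaler_eq0 mulf_eq0 invr_eq0 (negPf A0) (negPf ctx) invr_eq0.
have [H [pH HX HE]] := plane_exists fr hX al be ga.
exists H => // Q + BQ; case: BQ => [->//|[u -> /HE]|[k [j [y [yj ->]]]] /HE] /=.
  rewrite mulr1 /be -addrA subrK => e; case/eqP: (fA (ct u)).
  rewrite {1}e -scalerAr mulr1 ctD; congr (_ + _); apply: (etrans (ctZ _ _)).
    by rewrite /al ctZ divfK // mulrC.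
  by rewrite ct_tau mulr1.
rewrite mulr0 addr0 /ga => e.
(* On the second part the equation moves [y] away from [y0] by an [F]-multiple of [x], which [xesc]
   permits only for k = k0. *)
have e' : y = y0 + ((k - k0) / (A / ct x^-1)) *: x.
  have : al * (y - y0) = (k - k0)%:A.
    by rewrite scalerBl e mulrBr; ring.
  move/(congr1 (fun z => al^-1 * z)); rewrite mulKf // => h.
  rewrite -[y](subrK y0) h addrC; congr (_ + _).
  rewrite /al invrZ ?unitfE ?invr_eq0 // ?mulf_neq0 ?invr_eq0 // invrK.
  by rewrite -scalerAl -scalerAr mulr1 scalerA mulrC.
have s0 : (k - k0) / (A / ct x^-1) = 0 by apply: (xesc j); rewrite -e'.
have yE : y = y0 by rewrite e' s0 scale0r addr0.
have : (k - k0) / (A / ct x^-1) == 0 by rewrite s0.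
rewrite mulf_eq0 invr_eq0 mulf_eq0 invr_eq0 (negPf A0) (negPf ctx) !orbF subr_eq0.
by move=> /eqP ->; rewrite yE.
Qed.

End NormalForm.

(** * Baer subplanes *)

Lemma card_II_finpred (T : finType) (P : {pred T}) : [set` P] #= `I_#|P|.
Proof.
have h : @enum_val T P @` setT = [set` P].
  apply/seteqP; split=> [_ [i _ <-]|x Px] /=; first exact: enum_valP.
  by exists (enum_rank_in Px x) => //; rewrite enum_rankK_in.
rewrite card_eq_sym -h; apply: (card_eq_trans card_II); rewrite card_eq_sym.
by apply: inj_card_eq => i j _ _; exact: enum_val_inj.
Qed.

Lemma card_II_image (T : finType) (U : Type) (g : T -> U) (P : {pred T}) :
  {in P &, injective g} -> g @` [set` P] #= `I_#|P|.
Proof.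
move=> gi; apply: card_eq_trans (card_II_finpred P); apply: inj_card_eq.
by move=> x y; rewrite !inE; exact: gi.
Qed.

Lemma card_pred_image (T : finType) (U : Type) (g : T -> U) (P : {pred T}) (B : set U) n :
  injective g -> (forall y, B y <-> exists2 x, x \in P & y = g x) -> B #= `I_n -> #|P| = n.
Proof.
move=> gi hB Bn; apply/card_eq_II.
have e : B = g @` [set` P].
  by apply/seteqP; split=> [y /hB[x Px ->]|y [x Px <-]]; [exists x|apply/hB; exists x].
rewrite e in Bn; apply: card_eq_trans Bn; rewrite card_eq_sym.
by apply: card_II_image => x y _ _ /gi.
Qed.

Lemma dim_add_points (F : fieldType) (V : vectType F) (P Q : {vspace V}) :
  \dim P = 1%N -> \dim Q = 1%N -> P <> Q -> \dim (P + Q) = 2%N.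
Proof.
move=> dP dQ PQ; have := dimv_sum_cap P Q; rewrite dP dQ.
have : (\dim (P :&: Q) <= 1)%N by rewrite -dP dimvS ?capvSl.
case E : (\dim _) => [|[|//]] _; first by rewrite addn0.
case: PQ; have eP : (P :&: Q)%VS = P by apply/eqP; rewrite eqEdim capvSl E dP.
have eQ : (P :&: Q)%VS = Q by apply/eqP; rewrite eqEdim capvSr E dQ.
by rewrite -eP eQ.
Qed.

Lemma point_sub_point (F : fieldType) (V : vectType F) (P Q : {vspace V}) :
  \dim P = 1%N -> \dim Q = 1%N -> (P <= Q)%VS -> P = Q.
Proof. by move=> dP dQ PQ; apply/eqP; rewrite eqEdim PQ dP dQ. Qed.

Lemma scaler_inj_l (F : fieldType) (V : lmodType F) (x : V) (k l : F) :
  x != 0 -> k *: x = l *: x -> k = l.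
Proof.
move=> x0 /eqP; rewrite -subr_eq0 -scalerBl scaler_eq0 (negPf x0) orbF subr_eq0.
by move=> /eqP.
Qed.

Section Baer.
Variables (F : finFieldType) (L : fieldExtType F) (V : vectType F).
Variables (phi : 'Hom({ffun 'I_3 -> L}, V)) (ps : 'Hom((L * L * L)%type, V)) (e0 : V).
Hypothesis fr : frame phi ps e0.
Notation pt := (pt ps e0).
Variables (q : nat) (tau : L) (Vb : set {vspace V}).
Hypotheses (q1 : (1 < q)%N) (cF : #|F| = (q ^ 2)%N) (tau0 : tau != 0).

(* The affine points of pi, and the points of its line at infinity <t, q~>. *)
Definition bpt (l m : F) := pt (l *: tau, m%:A, 1).
Definition dir (l m : F) : {vspace V} := <[(ps (l *: tau, m%:A, 0))%R]>%VS.
Local Arguments bpt (l m)%_R.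
Local Arguments dir (l m)%_R.
Notation qt := (dir 1 0).
Notation t := (dir 0 1).
Definition bpi := (qt + t + bpt 0 0)%VS.
Notation ell := (t + bpt 0 0)%VS.

Hypotheses (hVb : subplane q bpi Vb) (hVbinf : Vb `&` points (t + qt)%VS = [set qt])
  (hell : real_line q bpi Vb ell) (hs : Vb (bpt 0 0)).

Lemma add_pt_limg U v : (U <= limg phi)%VS -> ((U + pt v) :&: limg phi)%VS = U.
Proof.
move=> US; apply/eqP; rewrite eqEsubv subv_cap addvSl US !andbT; apply/subvP=> x.
case/memv_capP=> /memv_addP[y yU [_ /vlineP[k ->] ->]] h.
suff -> : k = 0 by rewrite scale0r addr0.
apply: (@origin_scale _ _ _ _ _ _ fr k (k *: ps v + y)).
  by rewrite addrA -scalerDr addrC.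
by rewrite memvD ?memvZ ?(ps_limg fr) // (subvP US).
Qed.

Lemma dir_limg l m : (dir l m <= limg phi)%VS.
Proof. by rewrite -memvE (ps_limg fr). Qed.

Lemma bpt_inj l m l' m' : bpt l m = bpt l' m' -> l = l' /\ m = m'.
Proof.
by case/(pt_inj fr) => /(scaler_inj_l tau0)-> /(scaler_inj_l (oner_neq0 L))->.
Qed.

Lemma mem_dir l m l' m' : (dir l m <= dir l' m')%VS <-> exists k, l = k * l' /\ m = k * m'.
Proof.
rewrite -memvE; split=> [/vlineP[k]|[k [-> ->]]]; last first.
  by apply/vlineP; exists k; rewrite -linearZ /=; congr (ps (_, _, _)); rewrite ?scalerA ?scaler0.
rewrite -linearZ => /(ps_inj fr)[]; rewrite !scalerA.
by move=> /(scaler_inj_l tau0)-> /(scaler_inj_l (oner_neq0 L))->; exists k.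
Qed.

Lemma dim_dir l m : (l, m) != 0 -> \dim (dir l m) = 1%N.
Proof.
move=> n0; rewrite dim_vline; case: eqP => // h; case/eqP: n0.
have : ps (l *: tau, m%:A, 0) = ps (0, 0, 0).
  by rewrite h; apply/esym; exact: (linear0 ps).
move/(ps_inj fr) => -[/eqP + /eqP]; rewrite !scaler_eq0 (negPf tau0) oner_eq0 !orbF.
by move=> /eqP-> /eqP->.
Qed.

Lemma bpt_on_line l m l1 m1 l2 m2 :
  (bpt l m <= dir l1 m1 + bpt l2 m2)%VS <-> exists k, l = l2 + k * l1 /\ m = m2 + k * m1.
Proof.
rewrite (pt_le_add fr) ?dir_limg //.
have -> : (l *: tau, m%:A, 1) - (l2 *: tau, m2%:A, 1) = ((l - l2) *: tau, (m - m2)%:A, 0) :> L * L * L.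
  by rewrite -[LHS]/(l *: tau - l2 *: tau, m%:A - m2%:A, 1 - 1) subrr !scalerBl.
rewrite memvE; split=> [/mem_dir|[k [-> ->]]]; last first.
  by apply/mem_dir; exists k; rewrite ![_ + _ - _]addrAC !subrr !add0r.
by case=> k [h1 h2]; exists k; rewrite -h1 -h2 ![_ + (_ - _)]addrC !subrK.
Qed.

Lemma dir_on_line l m l1 m1 l2 m2 :
  (dir l m <= dir l1 m1 + bpt l2 m2)%VS -> (dir l m <= dir l1 m1)%VS.
Proof.
move=> h; rewrite -[dir l1 m1](@add_pt_limg _ (l2 *: tau, m2%:A, 1)) ?dir_limg //.
by rewrite subv_cap h dir_limg.
Qed.

Lemma dim_qt : \dim qt = 1%N. Proof. by apply: dim_dir; apply/eqP=> -[/eqP]; rewrite oner_eq0. Qed.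

Lemma qt_not_ell : ~ (qt <= ell)%VS.
Proof. by move=> /dir_on_line/mem_dir[k [/eqP]]; rewrite mulr0 oner_eq0. Qed.

Lemma Vb_dim P : Vb P -> \dim P = 1%N.
Proof. by case: hVb => h _ _ _ /h[]. Qed.

Lemma Vb_qt : Vb qt.
Proof. by have : [set qt] qt by []; rewrite -hVbinf => -[]. Qed.

Lemma Vb_affine P : Vb P -> P <> qt -> exists l m, P = bpt l m.
Proof.
move=> VP Pq; have [dP Ppi] : points bpi P by case: hVb => h _ _ _; exact: h.
have TS : (qt + t <= limg phi)%VS by rewrite subv_add !dir_limg.
have [PS|PS] := boolP (P <= limg phi)%VS.
  case: Pq; have : (P <= qt + t)%VS.
    by rewrite -(@add_pt_limg _ (0 *: tau, 0%:A, 1) TS) subv_cap Ppi.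
  by rewrite addvC => h; have : (Vb `&` points (t + qt)%VS) P by []; rewrite hVbinf.
have aP : affine_points phi P by split=> //; exact/negP.
have [w wT ->] := (pt_le_addP fr _ TS aP).1 Ppi.
move: wT => /memv_addP[_ /vlineP[k ->] [_ /vlineP[k' ->]]].
rewrite -!linearZ -linearD => /(ps_inj fr) ->; exists k, k'; rewrite /bpt; congr pt.
by congr (_, _, _); rewrite /= !(scale0r, scale1r, scaler0, addr0, add0r).
Qed.

Lemma secant_add P Q : Vb P -> Vb Q -> P <> Q -> secant Vb (P + Q)%VS.
Proof.
move=> VP VQ PQ; split; first by rewrite dim_add_points ?Vb_dim.
by exists P, Q; split=> //; split=> //; split; rewrite ?Vb_dim ?addvSl ?addvSr.
Qed.

(** The q + 1 points of V on the real line are all affine, because q~ is not on it. *)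
Lemma card_on_ell : #|[pred m | `[< Vb (bpt 0 m) >]]| = q.+1.
Proof.
case: hell => _ _; apply: (card_pred_image (g := bpt 0)) => [m m' /bpt_inj[]//|P].
split=> [[VP [dP Pell]]|[m]].
  have [l [m PE]] : exists l m, P = bpt l m.
    by apply: Vb_affine => // e; apply: qt_not_ell; rewrite -e.
  move: Pell VP; rewrite PE => /bpt_on_line[k [-> _]]; rewrite mulr0 addr0 => VP.
  by exists m; rewrite ?inE.
rewrite inE => h ->; split=> //; split; first exact: Vb_dim.
by apply/bpt_on_line; exists m; rewrite mulr0 mulr1 !add0r.
Qed.

Lemma secant_ell : secant Vb ell.
Proof.
have [dE _ _] := hell; split=> //.
have : (1 < #|[pred m | `[< Vb (bpt 0 m) >]]|)%N by rewrite card_on_ell ltnS ltnW.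
case/card_gt1P => m [m' [+ + mm']]; rewrite !inE => h h'.
exists (bpt 0 m), (bpt 0 m'); split; first by case/bpt_inj => _ e; rewrite e eqxx in mm'.
  by split=> //; split; [exact: Vb_dim|apply/bpt_on_line; exists m; rewrite mulr0 mulr1 !add0r].
by split=> //; split; [exact: Vb_dim|apply/bpt_on_line; exists m'; rewrite mulr0 mulr1 !add0r].
Qed.

Lemma secants_meet M N : secant Vb M -> secant Vb N -> M <> N ->
  exists P, [/\ Vb P, (P <= M)%VS & (P <= N)%VS].
Proof.
move=> sM sN MN; case: hVb => _ _ /(_ M N sM sN MN) [P VP] + _.
by rewrite subv_cap => /andP[PM PN]; exists P.
Qed.

Lemma qt_bpt l m : qt <> bpt l m.
Proof. by move=> e; have := pt_limg fr (l *: tau, m%:A, 1); rewrite -/(bpt l m) -e dir_limg. Qed.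

(* The secant through q~ and (l, m) meets the secant [ell] in a point of V. *)
Lemma Vb_project l m : Vb (bpt l m) -> Vb (bpt 0 m).
Proof.
move=> h; have s1 := secant_add Vb_qt h (@qt_bpt l m).
have [|P [VP PM PE]] := secants_meet s1 secant_ell.
  by move=> e; apply: qt_not_ell; rewrite -e addvSl.
have [l' [m' PE']] : exists l m, P = bpt l m.
  by apply: Vb_affine => // e; apply: qt_not_ell; rewrite -e.
move: PE PM VP; rewrite PE' => /bpt_on_line[k [-> _]] /bpt_on_line[k' [_ ->]].
by rewrite !mulr0 !addr0.
Qed.

(* Two distinct real lines meet in V, so [ell] is the only real line through t. *)
Lemma Vb_column l m m' : l != 0 -> Vb (bpt l m) -> Vb (bpt l m') -> m = m'.
Proof.
move=> l0 h h'; apply: contrapT => mm'.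
have nb : bpt l m <> bpt l m' by case/bpt_inj.
have s1 := secant_add h h' nb.
have lE m'' : (bpt l m'' <= ell)%VS -> ~ (l != 0).
  by case/bpt_on_line => k [-> _]; rewrite mulr0 addr0 eqxx.
have [|P [VP PM PE]] := secants_meet s1 secant_ell.
  by move=> e; apply: (lE m) => //; rewrite -e addvSl.
have [l' [m'' PE']] : exists l m, P = bpt l m.
  by apply: Vb_affine => // e; apply: qt_not_ell; rewrite -e.
have : (P <= t + bpt l m)%VS.
  apply: (subv_trans PM); rewrite subv_add addvSr /=; apply/bpt_on_line.
  by exists (m' - m); rewrite mulr0 addr0 mulr1 addrC subrK.
move: PE; rewrite PE' => /bpt_on_line[k [-> _]] /bpt_on_line[k' [+ _]].
by rewrite !mulr0 !addr0 => l00; rewrite -l00 eqxx in l0.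
Qed.

(* A secant of slope [a] through (0, m1) meets the secant m = 0 in a point of V;
   some slopes are therefore those of tangents. *)
Lemma Vb_tangent a m1 l m : m1 != 0 -> Vb (bpt 0 m1) -> l != 0 -> Vb (bpt l m) ->
  l = a * (m - m1) -> Vb (bpt (- (a * m1)) 0).
Proof.
move=> m10 h1 l0 h lE.
have nb : bpt 0 m1 <> bpt l m by case/bpt_inj => l00; rewrite -l00 eqxx in l0.
have s1 := secant_add h1 h nb; have s2 := secant_add Vb_qt hs (@qt_bpt 0 0).
have Ml : (bpt 0 m1 + bpt l m <= dir a 1 + bpt 0 m1)%VS.
  rewrite subv_add addvSr /=; apply/bpt_on_line; exists (m - m1).
  by split; [rewrite add0r mulrC|rewrite mulr1 addrC subrK].
have [|P [VP PM PE]] := secants_meet s1 s2.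
  move=> e; have : (bpt 0 m1 <= qt + bpt 0 0)%VS by rewrite -e addvSl.
  by case/bpt_on_line => k [_]; rewrite mulr0 addr0 => m1E; rewrite m1E eqxx in m10.
have {}PM := subv_trans PM Ml.
have [l' [m' PE']] : exists l m, P = bpt l m.
  apply: Vb_affine => // e; move: PM; rewrite e => /dir_on_line/mem_dir[k [+ +]].
  by rewrite mulr1 => + k0; rewrite -k0 mul0r => /eqP; rewrite oner_eq0.
move: PE PM VP; rewrite PE' => /bpt_on_line[k [_ ->]] /bpt_on_line[k' [->]].
rewrite mulr0 addr0 add0r mulr1 => /esym/eqP; rewrite addr_eq0 => /eqP ->.
by rewrite mulrN opprK mulrC.
Qed.

Lemma card_on_row m : Vb (bpt 0 m) -> #|[pred l | `[< Vb (bpt l m) >]]| = q.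
Proof.
move=> h; have [_ _ _ /(_ _ (secant_add Vb_qt h (@qt_bpt 0 m))) hM] := hVb.
(* [None] encodes q~, the point at infinity of this secant, which has to be subtracted from q +
   1. *)
pose g o := if o is Some l then bpt l m else qt.
pose P := [pred o : option F | if o is Some l then `[< Vb (bpt l m) >] else true].
have gi : injective g.
  by move=> [l|] [l'|] //= => [/bpt_inj[-> _]//|e|/qt_bpt//]; case: (@qt_bpt l m).
have := card_pred_image (P := P) gi _ hM; rewrite (cardD1 None) inE => hP.
apply: succn_inj; rewrite -[RHS]hP => [|Q].
  rewrite add1n; congr _.+1; rewrite -(fintype.card_image (@Some_inj _)); apply: eq_card => -[l|].
    by rewrite fintype.mem_image; [rewrite !inE|exact: Some_inj].
  by rewrite [in RHS]inE; apply/fintype.imageP => -[].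
split=> [[VQ [_ QM]]|[[l|] Po ->]].
- have [->|Qq] := pselect (Q = qt); first by exists None.
  have [l [m' QE]] := Vb_affine VQ Qq; move: QM VQ.
  rewrite QE => /bpt_on_line[k [_ ->]]; rewrite mulr0 addr0 => VQ; exists (Some l) => //.
  by rewrite inE.
- have Vl : Vb (bpt l m) by move: Po; rewrite inE.
  split=> //; split; first exact: Vb_dim.
  by apply/bpt_on_line; exists l; rewrite mulr0 mulr1 addr0 add0r.
- by split; [exact: Vb_qt|split; [exact: dim_qt|exact: addvSl]].
Qed.

(** By [Vb_project] the points off the real line lie in the q + 1 rows m for which (0, m) is in V;
    each row has q affine points, one of them on that line. *)
Lemma card_off_ell :
  #|[pred x : F * F | (x.2 != 0) && `[< Vb (bpt x.2 x.1) >]]| = (q.+1 * q.-1)%N.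
Proof.
rewrite -card_on_ell -sum_nat_const -sum1_card.
transitivity (\sum_(m | m \in [pred m | `[< Vb (bpt 0 m) >]])
    \sum_(l | (l != 0%R) && `[< Vb (bpt l m) >]) 1)%N.
  rewrite pair_big_dep /=; apply: eq_bigl => -[m l]; rewrite !inE /=.
  apply/andP/andP => [[l0 /asboolP h]|[_ /andP[-> ->]]//].
  by split; [apply/asboolP; exact: Vb_project h|rewrite l0; apply/asboolP].
apply: eq_bigr => m; rewrite inE => h; rewrite sum1_card.
rewrite -[in RHS](card_on_row h) [in RHS](cardD1 0) [in RHS]inE asboolT // add1n /=.
Qed.

(** Pigeonhole: by [Vb_column] the points off the real line have distinct coordinates l, and they
    are as many, q^2 - 1, as the nonzero elements of [F]. *)
Lemma Vb_column_exists l : l != 0 -> exists m, Vb (bpt l m).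
Proof.
move=> l0; pose E := [pred x : F * F | (x.2 != 0) && `[< Vb (bpt x.2 x.1) >]].
have inj : {in E &, injective snd}.
  move=> [m k] [m' k']; rewrite !inE /= => /andP[k0 /asboolP h] /andP[_ /asboolP h'] e.
  by rewrite -e in h' *; rewrite (Vb_column k0 h h').
have cE : #|[set x.2 | x in E]%SET| = #|[set~ (0 : F)%R]%SET|.
  rewrite card_in_imset // card_off_ell cardsC1 cF -subn1 -[in RHS](subn1).
  by case: (q) q1 => // n _; rewrite expnS expn1 /=; lia.
have sub : ([set x.2 | x in E] \subset [set~ (0 : F)%R])%SET.
  by apply/fintype.subsetP => _ /imsetP[x + ->]; rewrite !inE => /andP[].
have /eqP eE : ([set x.2 | x in E] == [set~ (0 : F)%R])%SET by rewrite eqEcard sub cE leqnn.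
have : l \in [set~ (0 : F)%R]%SET by rewrite !inE.
rewrite -eE => /imsetP[[m k]]; rewrite !inE /= => /andP[_ /asboolP h] ->.
by exists m.
Qed.

(** The value 0 at 0 records that s = (0, 0) is the one point kept on the real line. The last clause
    gives a line of pi missing the graph, from which the tangent planes of the second part are
    made. *)
Lemma baer_graph : exists (f : F -> F) (a c : F), [/\ a != 0, f 0 = 0,
  forall l m, l != 0 -> (Vb (bpt l m) <-> m = f l) & forall l, l != a * f l + c].
Proof.
have /boolp.choice[g hg] : forall l, exists m, l != 0 -> Vb (bpt l m).
  move=> l; have [->|l0] := eqVneq l 0; first by exists 0.
  by have [m h] := Vb_column_exists l0; exists m.
pose f l := if l == 0 then 0 else g l.
have fE l m : l != 0 -> (Vb (bpt l m) <-> m = f l).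
  move=> l0; rewrite /f (negPf l0); split=> [h|->]; last exact: hg.
  exact: Vb_column l0 h (hg _ l0).
have f0 : f 0 = 0 by rewrite /f eqxx.
have [m1 m10 h1] : exists2 m, m != 0 & Vb (bpt 0 m).
  have : (1 < #|[pred m | `[< Vb (bpt 0 m) >]]|)%N by rewrite card_on_ell ltnS ltnW.
  rewrite (cardD1 0) inE asboolT // add1n ltnS => /card_gt0P[m].
  by rewrite !inE => /andP[m0 /asboolP h]; exists m.
(* The row m = 0 has q affine points in V but q^2 affine points in all. *)
have [l1 h2] : exists l, ~ Vb (bpt l 0).
  apply: contrapT => h; have := card_on_row hs.
  have -> : #|[pred l | `[< Vb (bpt l 0) >]]| = #|F|.
    apply: eq_card => l; rewrite !inE; apply/asboolP.
    by apply: contrapT => hl; apply: h; exists l.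
  by rewrite cF; move: q1; case: (q) => [|[|n]] // _; rewrite expnS expn1; nia.
have l10 : l1 != 0 by apply: contra_notN h2 => /eqP ->.
(* This is the line joining (0, m1) in V to (l1, 0) outside V. A point of V on it with l nonzero
   would put (l1, 0) in V by [Vb_tangent]; at l = 0 the value [f 0 = 0] leaves l1, which is
   nonzero. *)
exists f, (- (l1 / m1)), l1; split=> //.
  by rewrite oppr_eq0 mulf_neq0 // invr_eq0.
move=> l; have [->|l0] := eqVneq l 0; first by rewrite f0 mulr0 add0r eq_sym.
apply/eqP=> e; apply: h2.
have -> : l1 = - (- (l1 / m1) * m1) by rewrite mulNr opprK divfK.
apply: (Vb_tangent m10 h1 l0 (m := f l)); first exact/fE.
by rewrite mulrBr [X in _ - X]mulNr divfK // opprK.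
Qed.
End Baer.
Arguments bpt {F L V} ps e0 tau (l m)%_R.
Arguments dir {F L V} ps tau (l m)%_R.

(** * Counting *)

Lemma card_II_disjointU (T : choiceType) (A B : set T) m n :
  A #= `I_m -> B #= `I_n -> (forall x, A x -> B x -> False) -> A `|` B #= `I_(m + n).
Proof.
move=> Am Bn AB; have fA : finite_set A by exists m.
have fB : finite_set B by exists n.
have [k Uk] : finite_set (A `|` B) by rewrite finite_setU.
suff -> : (m + n)%N = k by [].
rewrite -(card_fset_set Uk) fset_setU // finmap.cardfsU -fset_setI //.
rewrite (card_fset_set Am) (card_fset_set Bn).
by rewrite (_ : A `&` B = set0) ?fset_set0 ?finmap.cardfs0 ?subn0 // -subset0 => x [/AB].
Qed.

Lemma card_vspace_set (F : finFieldType) (V : vectType F) (U : {vspace V}) :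
  #|[set x : finvect_type V | x \in U]%SET| = (#|F| ^ \dim U)%N.
Proof.
case: V U => T c U; rewrite cardsE.
exact: (@card_vspace F (finvect_type (Vector.Pack c)) c U).
Qed.

(** [S] is a union of cosets of [U], and all cosets have the size of [U]. *)
Lemma card_translation_invariant (F : finFieldType) (V : vectType F) (U : {vspace V})
    (S : {set finvect_type V}) :
  (forall x w : V, x \in S -> w \in U -> x + w \in S) -> (#|F| ^ \dim U %| #|S|)%N.
Proof.
move=> SU; pose R : rel (finvect_type V) := fun x y => (y : V) - x \in U.
have eR : {in S & &, equivalence_rel R}.
  move=> x y z _ _ _; split=> [|xy]; first by rewrite /R subrr mem0v.
  rewrite /R in xy *; apply/idP/idP => h.
    by have := memvB h xy; rewrite opprB addrA subrK.
  by have := memvD h xy; rewrite addrA subrK.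
rewrite (card_uniform_partition (n := (#|F| ^ \dim U)%N) _ (equivalence_partitionP eR)).
  exact: dvdn_mull.
move=> A; case/imsetP=> x xS ->; rewrite -card_vspace_set.
pose g (w : finvect_type V) : finvect_type V := (x : V) + w.
have gi : injective g by move=> w w' /addrI.
rewrite -(card_imset [set w : finvect_type V | w \in U]%SET gi).
apply: eq_card => y; rewrite !inE; apply/andP/imsetP => [[yS yx]|[w]].
  by exists ((y : V) - x); [rewrite inE|rewrite /g addrC subrK].
by rewrite inE => wU ->; rewrite /R /g addrAC subrr add0r; split=> //; exact: SU.
Qed.

Section Count.
Variables (F : finFieldType) (L : fieldExtType F) (V : vectType F).
Variables (phi : 'Hom({ffun 'I_3 -> L}, V)) (ps : 'Hom((L * L * L)%type, V)) (e0 : V).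
Hypothesis fr : frame phi ps e0.
Hypotheses (hL : \dim {:L} = 3%N).
Notation pt := (pt ps e0).
Variables (X : {vspace V}) (ct : L -> F) (f : F -> F) (Lam : 'I_3 -> {vspace L}).
Hypothesis hX : forall x, x \in X <-> exists a, x = ps (a, 0, 0).
Hypotheses (dLam : forall i, \dim (Lam i) = 2%N)
  (Lam0 : forall y, (forall i, y \in Lam i) -> y = 0).

Lemma dim_Lam_cap i j : i != j -> \dim (Lam i :&: Lam j) = 1%N.
Proof.
move=> ij; have [a [b [ia ib ab all]]] := ord3_split i.
have [k [ik jk]] : exists k, i != k /\ j != k.
  case: (all j) => e; first by rewrite e eqxx in ij.
    by exists b; rewrite e.
  by exists a; rewrite e [b == a]eq_sym ia.
have [z [_ zi zk zj]] := vertex hL dLam Lam0 ik.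
have {}zj : z \notin Lam j by apply: zj; rewrite // eq_sym.
have ub : (\dim (Lam i :&: Lam j) < 2)%N.
  rewrite -(dLam i) ltn_neqAle dimvS ?capvSl // andbT.
  apply: contraNN zj => /eqP e; suff : (Lam i <= Lam j)%VS by move/subvP; apply.
  have /eqP <- : (Lam i :&: Lam j == Lam i)%VS by rewrite eqEdim capvSl e leqnn.
  exact: capvSr.
have := dimv_sum_cap (Lam i) (Lam j); rewrite !dLam => e.
by have := dimvS (subvf (Lam i + Lam j)); rewrite hL; lia.
Qed.

(** Inclusion and exclusion, with Q the order of [F]: three subspaces of Q^2 vectors, pairwise
    meeting in Q vectors and all three only in 0. *)
Lemma card_triangle : #|[set y : finvect_type L | [exists i, y \in Lam i]]%SET| =
  (3 * #|F| ^ 2 - 3 * #|F| + 1)%N.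
Proof.
pose i0 : 'I_3 := ord0; pose i1 : 'I_3 := lift ord0 ord0; pose i2 : 'I_3 := lift ord0 (lift ord0 ord0).
pose S i := [set y : finvect_type L | y \in Lam i]%SET.
have cS i : #|S i| = (#|F| ^ 2)%N by rewrite /S card_vspace_set dLam.
have cI i j : i != j -> #|(S i :&: S j)%SET| = #|F|.
  move=> ij; rewrite -[RHS]expn1 -(dim_Lam_cap ij) -card_vspace_set.
  by apply: eq_card => y; rewrite !inE memv_cap.
have -> : [set y : finvect_type L | [exists i, y \in Lam i]]%SET = (S i0 :|: S i1 :|: S i2)%SET.
  apply/setP=> y; rewrite !inE; apply/existsP/idP => [[[[|[|[|//]]] hi]]|].
  - by rewrite (_ : Ordinal hi = i0) => [->//|]; apply: val_inj.
  - by rewrite (_ : Ordinal hi = i1) => [->|]; rewrite ?orbT //; apply: val_inj.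
  - by rewrite (_ : Ordinal hi = i2) => [->|]; rewrite ?orbT //; apply: val_inj.
  by case/orP => [/orP[]|] h; [exists i0|exists i1|exists i2].
(* This is the form the triple intersection takes after distributing the third set over the union of
   the first two. *)
have cI3 : #|(S i0 :&: S i2 :&: (S i1 :&: S i2))%SET| = 1%N.
  rewrite -(cards1 (0 : finvect_type L)); apply: eq_card => y; rewrite !inE.
  apply/idP/eqP => [/andP[/andP[h0 h2] /andP[h1 _]]|->]; last by rewrite !mem0v.
  apply: Lam0 => -[[|[|[|//]]] hi].
  - by rewrite (_ : Ordinal hi = i0) //; apply: val_inj.
  - by rewrite (_ : Ordinal hi = i1) //; apply: val_inj.
  - by rewrite (_ : Ordinal hi = i2) //; apply: val_inj.
rewrite !cardsU !cS cI // finset.setIUl cardsU !cI // cI3.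
have : (1 < #|F|)%N by apply: finNzRing_gt1.
by move: #|F| => Q; rewrite expnS expn1; nia.
Qed.

(** The last coordinate separates the two affine pieces, each parametrised injectively, and X lies
    at infinity. *)
Lemma card_graph_cone : @graph_cone F L V ps e0 X ct f Lam
  #= `I_(1 + (#|F| ^ 3 + #|F| * (3 * #|F| ^ 2 - 3 * #|F| + 1))).
Proof.
pose g1 (u : finvect_type L) := pt (u, (f (ct u))%:A, 1).
pose g2 (x : F * finvect_type L) := pt (x.1%:A, x.2 : L, 0).
pose P2 := [pred x : F * finvect_type L | [exists i, x.2 \in Lam i]].
have -> : @graph_cone F L V ps e0 X ct f Lam =
    [set X] `|` ((g1 @` [set` predT]) `|` (g2 @` [set` P2])).
  apply/seteqP; split=> P.
    case=> [->|[u ->]|[k [i [y [yi ->]]]]]; first by left.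
      by right; left; exists u.
    by right; right; exists (k, y) => //; rewrite /= inE; apply/existsP; exists i.
  case=> [->|[[u _ <-]|[[k y] /existsP[i yi] <-]]]; first exact: Or31.
    by apply: Or32; exists u.
  by apply: Or33; exists k, i, y.
have cL : #|finvect_type L| = (#|F| ^ 3)%N.
  by rewrite -hL -card_vspace_set -cardsT; apply: eq_card => x; rewrite !inE memvf.
apply: card_II_disjointU; first exact: card_set1.
  apply: card_II_disjointU.
  - rewrite -cL; apply: card_II_image => x y _ _ /(pt_inj fr)[]//.
  - rewrite -card_triangle -(cardsT F) -cardsX.
    rewrite -[X in `I_X](_ : #|P2| = _).
      apply: card_II_image => -[k y] [k' y'] _ _ /(pt_inj fr)[h ->].
      by rewrite (scaler_inj_l (oner_neq0 L) h).
    by apply: eq_card => -[k y]; rewrite !inE.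
  - move=> _ [u _ <-] [[k y] _ /(pt_inj fr)[_ _ /eqP]].
    by rewrite eq_sym oner_eq0.
have XS : (X <= limg phi)%VS by apply: (spread_limg fr); apply: (spread_X fr hX).
move=> _ -> [[u _ e]|[x _ e]]; move: XS; rewrite -e; apply/negP; exact: (pt_limg fr).
Qed.

End Count.

(** * Frames obtained from bases over L *)

Definition comb (L : fieldType) (x0 x1 x2 : {ffun 'I_3 -> L}) (v : L * L * L) : {ffun 'I_3 -> L} :=
  [ffun i => v.1.1 * x0 i + v.1.2 * x1 i + v.2 * x2 i].

Section FrameOfBasis.
Variables (F : fieldType) (L : fieldExtType F) (V : vectType F).
Variables (phi : 'Hom({ffun 'I_3 -> L}, V)) (e0 : V).
Hypotheses (hphi : injective phi) (hV : \dim {:V} = (3 * \dim {:L}).+1)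
  (he0 : e0 \notin limg phi).

Lemma dim_limg_phi : \dim (limg phi) = (3 * \dim {:L})%N.
Proof.
have /eqP kerE : lker phi == 0%VS by apply/lker0P.
by rewrite limg_dim_eq ?kerE ?capv0 // !dimvf /dim /= card_ord.
Qed.

(** Independence over [L] makes the coordinate map injective, and a dimension count makes it onto
    Sigma. It commutes with scaling by [L], so rays correspond to spread elements. *)
Lemma frame_of_basis (x0 x1 x2 : {ffun 'I_3 -> L}) :
  (forall v, comb x0 x1 x2 v = 0 -> v = 0) ->
  exists2 ps, frame phi ps e0 & forall v, ps v = phi (comb x0 x1 x2 v).
Proof.
move=> indep; pose cb := comb x0 x1 x2.
have cbP : linear cb.
  move=> k u v; apply/ffunP=> i; rewrite !ffunE /= !mulrDl -!scalerAl !scalerDr.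
  by rewrite [RHS]addrACA [X in _ = X + _]addrACA.
have lin : linear (fun v => phi (cb v)) by move=> k u v; rewrite cbP linearP.
pose g : {linear (L * L * L)%type -> V} :=
  HB.pack (fun v => phi (cb v)) (@GRing.isLinear.Build F (L * L * L)%type V _ _ lin).
pose ps := linfun g.
have psE v : ps v = phi (cb v) by rewrite lfunE.
have cbB u v : cb (u - v) = cb u - cb v.
  by rewrite addrC -scaleN1r cbP scaleN1r addrC.
have psK : lker ps = 0%VS.
  apply/eqP/lker0P=> u v; rewrite !psE => /hphi e.
  by apply/eqP; rewrite -subr_eq0; apply/eqP/indep; rewrite -/(cb _) cbB e subrr.
have limgE : limg ps = limg phi.
  apply/eqP; rewrite eqEdim dim_limg_phi limg_dim_eq ?psK ?capv0 //.
  rewrite !dimvf /dim /= !mulSn addn0 addnA leqnn andbT.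
  by apply/subvP=> _ /memv_imgP[v _ ->]; rewrite psE memv_img ?memvf.
have cb_onto w : exists v, w = cb v.
  have : phi w \in limg ps by rewrite limgE memv_img ?memvf.
  by case/memv_imgP=> v _; rewrite psE => /hphi ->; exists v.
have cb0 : cb 0 = 0 by have := cbB 0 0; rewrite !subrr.
have cb_ray v a : cb (ray v a) = [ffun i => a * cb v i].
  by apply/ffunP=> i; rewrite !ffunE /ray /= !mulrDr !mulrA.
exists ps => //; split=> // [Z|].
  split=> [[w w0 hZ]|[v v0 hZ]].
    have [v vE] := cb_onto w; exists v => [|x].
      by apply: contraNneq w0 => v0; rewrite vE v0 cb0.
    by split=> [/hZ[a ->]|[a ->]]; [|apply/hZ]; exists a; rewrite psE cb_ray vE.
  exists (cb v) => [|x]; first by apply: contraNneq v0 => /indep ->.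
  by split=> [/hZ[a ->]|[a ->]]; [|apply/hZ]; exists a; rewrite psE cb_ray.
apply/eqP; rewrite eqEdim subvf hV dimv_disjoint_sum ?dim_limg_phi ?dim_vline.
  by case: eqP he0 => [->|_ _]; rewrite ?mem0v //= addn1.
apply/eqP; rewrite -subv0; apply/subvP=> x /memv_capP[hx /vlineP[k xE]].
move: hx; rewrite xE rpredZeq (negPf he0) orbF => /eqP ->.
by rewrite scale0r mem0v.
Qed.

(** Serves the representations of class MPS, and the construction as long as no adapted basis is
    known. *)
Lemma standard_frame : exists ps, frame phi ps e0.
Proof.
pose d (j : nat) : {ffun 'I_3 -> L} := [ffun i : 'I_3 => ((i : nat) == j)%:R].
have [|ps fr _] := @frame_of_basis (d 0%N) (d 1%N) (d 2%N); last by exists ps.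
move=> [[a b] c] /ffunP h; move: (h ord0) (h (lift ord0 ord0)) (h (lift ord0 (lift ord0 ord0))).
by rewrite !ffunE /= !(mulr0, mulr1, addr0, add0r) => -> -> ->.
Qed.
End FrameOfBasis.

(** * The size of a set of class MPS *)

Section MPSCount.
Variables (F : finFieldType) (L : fieldExtType F) (V : vectType F).
Variables (phi : 'Hom({ffun 'I_3 -> L}, V)) (ps : 'Hom((L * L * L)%type, V)) (e0 : V).
Hypothesis fr : frame phi ps e0.
Notation pt := (pt ps e0).

Variables (m : nat) (m2 : (2 <= m)%N).

(** The affine part consists of cosets of Omega. Besides Omega itself, the cone at infinity comes
    from the single point [P0]: it meets only Y if [P0] lies in Y, and otherwise Y and one further
    spread element for each vector of Omega. *)
Lemma MPS_card B : MPS_set phi m B -> exists k, B #= `I_(1 + #|F| ^ m.-1 * k).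
Proof.
case=> Y [Om [D [B1 [[sY OmY dOm] [[dD DOm dDel dt1] [[B1D B1bl [P0 hP0] B1t] ->]]]]]].
have OmS : (Om <= limg phi)%VS := subv_trans OmY (spread_limg fr sY).
pose K := cone Om B1.
have B1P0 : B1 P0 /\ points (D :&: limg phi)%VS P0.
  by have : [set P0] P0 by []; rewrite -hP0.
have [[p0 P0E] dP0] : (exists p0, P0 = <[p0]>%VS) /\ \dim P0 = 1%N.
  by case: B1P0 => _ [dP0 _]; split=> //; exact: vline_of_dim1.
have p00 : p0 != 0 by move: dP0; rewrite P0E dim_vline; case: eqP.
have [p0D p0S] : p0 \in D /\ p0 \in limg phi.
  by case: B1P0 => _ [_]; rewrite P0E -memvE memv_cap => /andP.
have Omp0 : p0 \notin Om.
  apply: contraNN p00 => h; have : p0 \in (D :&: Om)%VS by rewrite memv_cap p0D.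
  by rewrite DOm memv0.
pose S := [set x : finvect_type V | `[< exists2 v, x = ps v & K (pt v) >]]%SET.
have SP (x : V) : (x : finvect_type V) \in S <-> exists2 v, x = ps v & K (pt v).
  by rewrite finset.in_set; split=> /asboolP.
pose g (x : finvect_type V) : {vspace V} := <[e0 + (x : V)]>%VS.
have AffE : K `\` points (limg phi) = g @` [set` S].
  apply/seteqP; split=> [P [KP PS]|_ [x + <-]].
    have aP : affine_points phi P.
      by case: KP => dP _; split=> // h; apply: PS.
    have [v PE] := affineP fr aP; exists (ps v); last by rewrite PE.
    by apply/SP; exists v => //; rewrite -PE.
  move=> /SP[v -> KP]; split=> // -[_].
  by apply/negP; exact: (pt_limg fr).
have SOm : (#|F| ^ m.-1 %| #|S|)%N.
  rewrite -dOm; apply: card_translation_invariant => x w.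
  move=> /SP[v -> [dv [a aB1 va]]] wOm; apply/SP.
  have [w' wE] := limg_ps fr (subvP OmS _ wOm).
  exists (v + w'); first by rewrite linearD wE.
  split; first exact: (dim_pt fr).
  have vm : e0 + ps v \in (Om + a)%VS by rewrite memvE.
  exists a => //; rewrite -memvE linearD addrA; apply: (memvD vm).
  by have := subvP (addvSl Om a) _ wOm; rewrite wE.
have cAff : K `\` points (limg phi) #= `I_#|S|.
  by rewrite AffE; apply: card_II_image => x y /SP[v -> _] /SP[w -> _] /(pt_inj fr) ->.
pose I := [set Z | spread phi Z /\ exists2 P, K P & (P <= Z)%VS].
have disj P : (K `\` points (limg phi)) P -> I P -> False.
  move=> [[dP _] PS] [sP _]; apply: PS; split=> //; exact: (spread_limg fr sP).
(* Since [m >= 2], Omega has a point, and it lies both in the cone and in Y. *)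
have IY : I Y.
  split=> //; have Om0 : vpick Om != 0 by rewrite vpick0 -dimv_eq0 dOm; case: (m) m2 => [|[]].
  exists <[vpick Om]>%VS; last by rewrite -memvE (subvP OmY) ?memv_pick.
  split; first by rewrite dim_vline Om0.
  by exists P0; [case: B1P0|rewrite -memvE (subvP (addvSl _ _)) ?memv_pick].
(* The join of Omega with an affine point meets Sigma in Omega only, hence inside Y. A spread
   element other than Y therefore meets the cone through [P0], and the coefficient of [p0] can be
   scaled to 1. *)
have IE Z : I Z -> Z <> Y -> exists2 w, w \in Om & p0 + w \in Z.
  case=> sZ [P [dP [a aB1 PK]] PZ] ZY.
  have [x PE] := vline_of_dim1 dP.
  have x0 : x != 0 by move: dP; rewrite PE dim_vline; case: eqP.
  have xZ : x \in Z by rewrite memvE -PE.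
  have xOm : x \in Om -> False.
    by move=> h; apply: ZY; apply: (spread_meet fr sZ sY x0 xZ); exact: (subvP OmY).
  have xS := subvP (spread_limg fr sZ) _ xZ.
  have [da aD] := B1D _ aB1.
  have aS : (a <= limg phi)%VS.
    apply: contraT => aS; case: xOm; have := affineP fr (conj da (fun h => negP aS h)).
    case=> v aE; rewrite -(add_pt_limg fr v OmS) memv_cap xS andbT memvE -PE -aE //.
  have aP0 : a = P0.
    have : (B1 `&` points (D :&: limg phi)%VS) a by split=> //; split=> //; rewrite subv_cap aD.
    by rewrite hP0.
  move: PK; rewrite PE -memvE aP0 P0E => /memv_addP[w wOm [_ /vlineP[k ->] xE]].
  have k0 : k != 0.
    by apply: contra_notN xOm => /eqP k0; rewrite xE k0 scale0r addr0.
  exists (k^-1 *: w); first exact: memvZ.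
  have -> : p0 + k^-1 *: w = k^-1 *: x; last exact: memvZ.
  by rewrite xE scalerDr scalerA mulVf // scale1r addrC.
have finish k : I #= `I_(1 + #|F| ^ m.-1 * k) ->
    exists k', (K `\` points (limg phi)) `|` I #= `I_(1 + #|F| ^ m.-1 * k').
  case/dvdnP: SOm => k1 SE cI; exists (k1 + k)%N.
  rewrite (_ : (1 + _)%N = (#|S| + (1 + #|F| ^ m.-1 * k))%N); last by rewrite SE; nia.
  exact: card_II_disjointU.
have [p0Y|p0Y] := boolP (p0 \in Y).
  apply: (finish 0%N); rewrite muln0 addn0 (_ : I = [set Y]); first exact: card_set1.
  apply/seteqP; split=> [Z IZ|_ ->] //=; apply: contrapT => ZY.
  have [w wOm wZ] := IE _ IZ ZY; apply: ZY; case: IZ => sZ _.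
  apply: (spread_meet fr sZ sY _ wZ); last by rewrite memvD // (subvP OmY).
  by apply: contraNneq Omp0 => /eqP; rewrite addr_eq0 => /eqP->; rewrite memvN.
apply: (finish 1%N); rewrite muln1.
have pw0 w : w \in Om -> p0 + w != 0.
  by move=> wOm; apply: contraNneq Omp0 => /eqP; rewrite addr_eq0 => /eqP->; rewrite memvN.
have pwY w : w \in Om -> p0 + w \notin Y.
  by move=> wOm; rewrite rpredDr // (subvP OmY).
(* For vectors outside Omega the choice is the dummy value 0. *)
have /boolp.choice[Zf hZf] : forall w : finvect_type V, exists Z,
    (w : V) \in Om -> spread phi Z /\ p0 + (w : V) \in Z.
  move=> w; have [wOm|_] := boolP ((w : V) \in Om); last by exists 0%VS.
  have [|Z sZ wZ] := @spread_through _ _ _ _ _ _ fr (p0 + (w : V)) _ (pw0 _ wOm).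
    by rewrite memvD // (subvP OmS).
  by exists Z.
pose OmP := [set w : finvect_type V | (w : V) \in Om]%SET.
have -> : I = [set Y] `|` (Zf @` [set` OmP]).
  apply/seteqP; split=> [Z IZ|Z [->//|[w + <-]]].
    have [->|ZY] := pselect (Z = Y); [by left|right].
    have [w wOm wZ] := IE _ IZ ZY; have [sZf wZf] := hZf w wOm.
    exists w; first by rewrite /= inE.
    by case: IZ => sZ _; apply: (spread_meet fr sZf sZ (pw0 w wOm)).
  rewrite /= inE => wOm; have [sZ wZ] := hZf w wOm; split=> //.
  exists <[p0 + (w : V)]>%VS; last by rewrite -memvE.
  split; first by rewrite dim_vline pw0.
  exists P0; first by case: B1P0.
  by rewrite -memvE P0E addrC memv_add // memv_line.
rewrite -dOm -card_vspace_set; apply: card_II_disjointU; first exact: card_set1.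
  apply: card_II_image => w w'; rewrite !inE => wOm w'Om e.
  have [sZ wZ] := hZf w wOm; have [sZ' wZ'] := hZf w' w'Om.
  (* If two distinct vectors gave the same element, it would contain their difference, a nonzero
     vector of Y, and so would be Y. *)
  rewrite -e in wZ'; apply/eqP; rewrite -subr_eq0; apply: contraNT (pwY w wOm) => ww'.
  suff <- : Zf w = Y by [].
  apply: (spread_meet fr sZ sY ww').
    have -> : (w : V) - w' = (p0 + (w : V)) - (p0 + (w' : V)) by rewrite opprD addrACA subrr add0r.
    exact: memvB.
  by apply: (subvP OmY); exact: memvB.
move=> _ -> [w + e]; rewrite /= inE => wOm; have [_ wZ] := hZf w wOm.
by have := pwY _ wOm; rewrite -e wZ.
Qed.
End MPSCount.

(** * Coordinates of the construction *)

(** The functional is the coefficient of [tau] modulo [U]; uniqueness of that coefficient yields its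
    linearity. *)
Lemma functional_with_kernel (F : fieldType) (W : vectType F) (U : {vspace W}) (tau : W) :
  tau \notin U -> (U + <[tau]>)%VS = fullv ->
  exists ct : W -> F, [/\ forall a b, ct (a + b) = ct a + ct b,
    forall (k : F) a, ct (k *: a) = k * ct a, ct tau = 1,
    forall u, (u \in U) = (ct u == 0) & forall u, u - ct u *: tau \in U].
Proof.
move=> tU full.
have /boolp.choice[ct hct] : forall u, exists k : F, u - k *: tau \in U.
  move=> u; have : u \in (U + <[tau]>)%VS by rewrite full memvf.
  by case/memv_addP=> w wU [_ /vlineP[k ->] ->]; exists k; rewrite addrK.
have uniq u k : u - k *: tau \in U -> ct u = k.
  move=> h; have : (k - ct u) *: tau \in U.
    have -> : (k - ct u) *: tau = (u - ct u *: tau) - (u - k *: tau).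
      by rewrite scalerBl opprB [RHS]addrC addrA subrK.
    exact: memvB.
  by rewrite rpredZeq (negPf tU) orbF subr_eq0 => /eqP.
exists ct; split=> //.
- move=> a b; apply: uniq; rewrite scalerDl opprD addrACA; exact: memvD.
- by move=> k a; apply: uniq; rewrite -scalerA -scalerBr; exact: memvZ.
- by apply: uniq; rewrite scale1r subrr mem0v.
move=> u; apply/idP/eqP => [uU|u0]; first by apply: uniq; rewrite scale0r subr0.
by have := hct u; rewrite u0 scale0r subr0.
Qed.

(** * The cones of the construction in coordinates *)

Section Decode.
Variables (F : finFieldType) (L : fieldExtType F) (V : vectType F).
Variables (phi : 'Hom({ffun 'I_3 -> L}, V)) (ps : 'Hom((L * L * L)%type, V)) (e0 : V).
Hypothesis fr : frame phi ps e0.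
Notation pt := (pt ps e0).
Variables (q : nat) (tau rho : L) (Vb : set {vspace V}).
Hypothesis tau0 : tau != 0.
Notation bpt := (bpt ps e0 tau).
Notation qt := (dir ps tau 1%R 0%R).
Notation t := (dir ps tau 0%R 1%R).
Notation ell := (t + bpt 0%R 0%R)%VS.
Hypotheses (hVb : subplane q (bpi ps e0 tau) Vb) (hVbinf : Vb `&` points (t + qt)%VS = [set qt]).
Variables (U : {vspace L}) (ct : L -> F) (f : F -> F) (X : {vspace V}).
Variables (Li : 'I_3 -> {vspace V}) (Lam : 'I_3 -> {vspace L}).
Hypotheses (UE : U = (<[1]> + <[rho]>)%VS) (ctD : forall a b, ct (a + b) = ct a + ct b)
  (ctZ : forall (k : F) a, ct (k *: a) = k * ct a) (ct_tau : ct tau = 1)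
  (ker_ct : forall u, (u \in U) = (ct u == 0)) (ctU : forall u, u - ct u *: tau \in U).
Hypotheses (f0 : f 0 = 0) (hf : forall l m, l != 0 -> (Vb (bpt l m) <-> m = f l)).
Hypotheses (hLam : forall i y, (y \in Lam i) = (ps (0, y, 0) \in Li i))
  (hLi : forall i, \dim (Li i) = 2%N)
  (hLiX' : forall i x, x \in Li i -> exists y, x = ps (0, y, 0)).

Let p : {vspace V} := <[(ps (1, 0, 0))%R]>%VS.
Let r : {vspace V} := <[(ps (rho, 0, 0))%R]>%VS.
Let h : {vspace V} := <[e0]>%VS.

Lemma on_affine_line w v P : affine_points phi P ->
  (P <= <[ps w]> + pt v)%VS <-> exists k, P = pt (v + k *: w).
Proof.
move=> aP; have US : (<[ps w]> <= limg phi)%VS by rewrite -memvE (ps_limg fr).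
split=> [/(pt_le_addP fr _ US aP)[w' /vlineP[k e] ->]|[k ->]].
  by exists k; congr pt; congr (_ + _); apply: (ps_inj fr); rewrite e linearZ.
by rewrite (pt_le_add fr) // addrAC subrr add0r linearZ memvZ // memv_line.
Qed.

Lemma affine_sub_cone (W a P : {vspace V}) : (W <= limg phi)%VS -> affine_points phi P ->
  (P <= W + a)%VS -> ~ (a <= limg phi)%VS.
Proof.
move=> WS [_ PS] PWa aS; apply: PS; apply: (subv_trans PWa).
by rewrite subv_add WS.
Qed.

Let Bbar := cone r ((Vb `\` points ell) `|` [set bpt 0 0]).
Let Btilde := cone h [set P | exists i, points (Li i) P] `\` points (limg phi).

(** The apex r adds multiples of rho to the first coordinate, and [f 0 = 0] accounts for s. The
    point q~ of V contributes no affine point. *)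
Lemma BbarP b : affine_points phi b ->
  Bbar b <-> exists l k, b = pt (l *: tau + k *: rho, (f l)%:A, 1).
Proof.
move=> ab; have rS : (r <= limg phi)%VS by rewrite -memvE (ps_limg fr).
have E l k : (l *: tau, (f l)%:A, 1) + k *: (rho, 0, 0) =
    (l *: tau + k *: rho, (f l)%:A, 1) :> L * L * L.
  by rewrite -[LHS]/(l *: tau + k *: rho, (f l)%:A + k *: 0, 1 + k *: 0) scaler0 !addr0.
split=> [[_ [a aV bra]]|[l [k bE]]].
  suff [l aE] : exists l, a = bpt l (f l).
    move: bra; rewrite aE => /(on_affine_line _ _ ab)[k ->].
    by exists l, k; rewrite E.
  case: aV => [[Va aell]|->]; last by exists 0; rewrite f0.
  have aqt : a <> qt.
    by move=> e; apply: (affine_sub_cone rS ab bra); rewrite e (dir_limg fr).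
  have [l [m aE]] := Vb_affine fr hVb hVbinf Va aqt.
  have l0 : l != 0.
    apply/eqP => l0; apply: aell; split; first by rewrite aE (dim_pt fr).
    by rewrite aE l0; apply/(bpt_on_line fr tau0); exists m; rewrite mulr0 mulr1 !add0r.
  by exists l; rewrite aE; congr (bpt _ _); apply/hf; rewrite -?aE.
split; first by case: ab.
exists (bpt l (f l)); last by apply/(on_affine_line _ _ ab); exists k; rewrite E.
have [->|l0] := eqVneq l 0; [by right; rewrite f0|left].
split; first exact/hf.
by move=> [_ /(bpt_on_line fr tau0)[k' [lE _]]]; move: l0; rewrite lE mulr0 addr0 eqxx.
Qed.

Lemma BtildeP b : affine_points phi b ->
  Btilde b <-> exists i y, y \in Lam i /\ b = pt (0, y, 0).
Proof.
move=> ab; have hE : h = pt 0 by rewrite /h /pt linear0 addr0.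
have LiS i : (Li i <= limg phi)%VS.
  by apply/subvP=> x /hLiX'[y ->]; rewrite (ps_limg fr).
split=> [[[_ [a [i [da aLi]] bha]] _]|[i [y [yi bE]]]].
  have aS := subv_trans aLi (LiS i).
  move: bha; rewrite addvC hE => /(pt_le_addP fr _ aS ab)[w wa ->].
  have [y wE] := hLiX' (subvP aLi _ wa).
  move: wa; rewrite wE => wa; exists i, y; rewrite hLam (subvP aLi) // add0r; split=> //.
  by rewrite (ps_inj fr wE).
split; last by case: ab => _ bS [_].
have bh (a : {vspace V}) : ps (0, y, 0) \in a -> (b <= h + a)%VS.
  by move=> ya; rewrite bE -memvE memv_add // memv_line.
split; first by case: ab.
(* For [y = 0] the point is the apex h, which lies on every generator, so any point of the line
   serves as base point. *)
have [y0|y0] := eqVneq y 0.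
  have Li0 : vpick (Li i) != 0 by rewrite vpick0 -dimv_eq0 hLi.
  exists <[vpick (Li i)]>%VS; first by exists i; split; rewrite ?dim_vline ?Li0 // -memvE memv_pick.
  by apply: bh; rewrite y0 (_ : ps _ = 0) ?mem0v //; exact: (linear0 ps).
exists <[(ps (0, y, 0))%R]>%VS; last by apply: bh; exact: memv_line.
exists i; split; last by rewrite -memvE -hLam.
rewrite dim_vline; case: eqP => // y00; case/eqP: y0.
have : ps (0, y, 0) = ps 0 by rewrite y00 linear0.
by case/(ps_inj fr).
Qed.

(** The apex p adds elements of [F] to the first coordinate; together with the multiples of rho this
    fills a coset of [U], on which [ct] is constant. *)
Lemma cone_normal_form :
  (cone p (Bbar `|` Btilde) `\` points (limg phi)) `|` [set X] =
  @graph_cone F L V ps e0 X ct f Lam.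
Proof.
have pS : (p <= limg phi)%VS by rewrite -memvE (ps_limg fr).
have E (u v w : L) k : (u, v, w) + k *: (1, 0, 0) = (u + k%:A, v, w) :> L * L * L.
  by rewrite -[LHS]/(u + k%:A, v + k *: 0, w + k *: 0) scaler0 !addr0.
apply/seteqP; split=> P.
  case=> [[[dP [b bB Ppb]] PS]|->]; last exact: Or31.
  have aP : affine_points phi P by split=> // h'; apply: PS.
  have bS := affine_sub_cone pS aP Ppb.
  have ab : affine_points phi b by split=> //; case: bB => [[]|[[]]].
  case: bB => [/(BbarP ab)[l [k bE]]|/(BtildeP ab)[i [y [yi bE]]]].
    move: Ppb; rewrite bE => /(on_affine_line _ _ aP)[k' ->]; rewrite E.
    apply: Or32; exists (l *: tau + k *: rho + k'%:A).
    suff -> : ct (l *: tau + k *: rho + k'%:A) = l by [].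
    have c0 : ct (k *: rho + k'%:A) = 0.
      apply/eqP; rewrite -ker_ct UE addrC memv_add ?memvZ ?memv_line //.
    by rewrite -addrA ctD c0 addr0 ctZ ct_tau mulr1.
  move: Ppb; rewrite bE => /(on_affine_line _ _ aP)[k' ->]; rewrite E add0r.
  by apply: Or33; exists k', i, y.
case=> [->|[u ->]|[k [i [y [yi ->]]]]]; first by right.
  left; split; last by move=> [_]; apply/negP; exact: (pt_limg fr).
  split; first exact: (dim_pt fr).
  have : u - ct u *: tau \in (<[1]> + <[rho]>)%VS by rewrite -UE.
  case/memv_addP=> _ /vlineP[k' ->] [_ /vlineP[k ->] uE].
  exists (pt (ct u *: tau + k *: rho, (f (ct u))%:A, 1)).
    by left; apply/BbarP; [exact: (pt_affine fr)|exists (ct u), k].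
  apply/(on_affine_line _ _ (pt_affine fr _)); exists k'; rewrite E; congr (pt (_, _, _)).
  by rewrite -addrA [k *: _ + _]addrC -uE addrC subrK.
left; split; last by move=> [_]; apply/negP; exact: (pt_limg fr).
split; first exact: (dim_pt fr).
exists (pt (0, y, 0)); first by right; apply/BtildeP; [exact: (pt_affine fr)|exists i, y].
by apply/(on_affine_line _ _ (pt_affine fr _)); exists k; rewrite E add0r.
Qed.

End Decode.

(** * Non-equivalence by divisibility *)

Lemma count_contradiction (q q1 m k : nat) : (1 < q)%N -> (2 <= m)%N -> (q ^ 6 = q1 ^ m)%N ->
  ((q ^ 2) ^ 3 + q ^ 2 * (3 * (q ^ 2) ^ 2 - 3 * q ^ 2 + 1) = q1 ^ m.-1 * k)%N -> False.
Proof.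
move=> q1_ m2 e c.
(* Compare squares: q^6 = q1^m divides q1^(2(m-1)) because m <= 2(m-1). *)
have d3 : (q ^ 3 %| q1 ^ m.-1)%N.
  rewrite -(@dvdn_pexp2r _ _ 2) // -!expnM (_ : 3 * 2 = 6)%N // e dvdn_exp2l //; lia.
have := dvdn_trans d3 (dvdn_mulr k (dvdnn _)); rewrite -c.
(* The count is q^2 modulo q^3; [l1] keeps the truncated subtraction exact. *)
have -> : ((q ^ 2) ^ 3 + q ^ 2 * (3 * (q ^ 2) ^ 2 - 3 * q ^ 2 + 1) =
    q ^ 3 * (4 * q ^ 3 - 3 * q) + q ^ 2)%N.
  have l1 : (q ^ 4 <= q ^ 6)%N by rewrite leq_pexp2l // ltnW.
  rewrite -!expnM mulnDr !mulnBr !(mulnCA _ 3) !(mulnCA _ 4) -!expnD -expnSr muln1 /=; lia.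
have q20 : (0 < q ^ 2)%N by rewrite expn_gt0 (ltnW q1_).
rewrite (dvdn_addr _ (dvdn_mulr _ (dvdnn _))) => h; have := dvdn_leq q20 h.
by rewrite leq_exp2l.
Qed.

Lemma card_collineation (G G' : geometry) (f : gcarrier G -> gcarrier G') (B : set (gcarrier G)) :
  @collineation G G' f -> B `<=` @gpoints G -> f @` B #= B.
Proof.
move=> [[_ fi _] _] Bp; apply: inj_card_eq => x y /set_mem xB /set_mem yB.
by apply: fi; apply/mem_set; exact: Bp.
Qed.

(** Both the collineation onto the model and that of the equivalence preserve cardinality, so a
    single number would have to satisfy both counts. *)
Lemma not_equivalent_MPS (q : nat) (F : finFieldType) (L : fieldExtType F) (V : vectType F)
    (phi : 'Hom({ffun 'I_3 -> L}, V)) (B : set {vspace V}) :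
  (1 < q)%N -> B `<=` @BC_points F L V phi ->
  B #= `I_(1 + ((q ^ 2) ^ 3 + q ^ 2 * (3 * (q ^ 2) ^ 2 - 3 * q ^ 2 + 1))) ->
  forall B', @class_MPS (q ^ 6) (BC phi) B' -> ~ @equivalent (BC phi) B B'.
Proof.
move=> q1_ BP cB B' [q1 [m [F1 [L1 [V1 [phi1 [B1 [f []]]]]]]]].
move=> [pq1 m2 e] [[cF1 dL1 dV1 iphi1] [M1 cf ->]] [g cg gE].
have dlim : \dim (limg phi1) = (3 * m)%N by rewrite -dL1; exact: dim_limg_phi.
have [e1 e1S] : exists e1, e1 \notin limg phi1.
  have : ~~ (fullv <= limg phi1)%VS.
    by apply/negP => /dimvS; rewrite dV1 dlim ltnn.
  by move/subvPn=> [e1 _ e1S]; exists e1.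
have dV1' : \dim {:V1} = (3 * \dim {:L1}).+1 by rewrite dL1.
have [ps1 fr1] := standard_frame iphi1 dV1' e1S.
have [k cB1] := MPS_card fr1 m2 M1.
have B1P : B1 `<=` @gpoints (BC phi1).
  case: M1 => [Y [Om [D [B2 [_ [_ [_ ->]]]]]]] P [[[dP _] PS]|[sP _]]; [left|by right].
  by split=> // h; apply: PS.
rewrite cF1 in cB1.
have := card_collineation cf B1P; have := card_collineation cg BP; rewrite gE => E1 E2.
have : `I_(1 + ((q ^ 2) ^ 3 + q ^ 2 * (3 * (q ^ 2) ^ 2 - 3 * q ^ 2 + 1))) #= `I_(1 + q1 ^ m.-1 * k).
  apply: (card_eq_trans _ cB1); apply: (card_eq_trans _ E2); rewrite card_eq_sym.
  exact: card_eq_trans E1 cB.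
move/card_eq_II/addnI; exact: count_contradiction.
Qed.

Lemma spread_generated (F : fieldType) (L : fieldExtType F) (V : vectType F)
    (phi : 'Hom({ffun 'I_3 -> L}, V)) (ps : 'Hom((L * L * L)%type, V)) e0 (fr : frame phi ps e0) Z w :
  spread phi Z -> ps w \in Z -> w != 0 -> forall x, x \in Z <-> exists a, x = ps (ray w a).
Proof.
move=> sZ wZ w0; have [Z' [sZ' hZ']] := spread_exists fr w0.
suff -> : Z = Z' by [].
apply: (spread_meet fr sZ sZ' _ wZ).
  by apply: contraNneq w0 => e; apply/eqP/(ps_inj fr); rewrite e linear0.
by apply/hZ'; exists 1; rewrite /ray !mul1r; case: (w) => [[]].
Qed.

(** * Choice of coordinates for the construction *)

Theorem theorem8
  (q : nat) (F : finFieldType) (L : fieldExtType F) (V : vectType F)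
  (Sigma : {vspace V}) (phi : 'Hom({ffun 'I_3 -> L}, V))
  (X X' p Gamma r qt Gamma' pi t ell s l tt h : {vspace V})
  (Vb : set {vspace V}) (Li : 'I_3 -> {vspace V})
  (hq : prime_power q) (hF : #|F| = (q ^ 2)%N) (hL : \dim {:L} = 3%N)
  (hV : \dim {:V} = 10%N)
  (hphi : injective phi) (hSigma : limg phi = Sigma)
  (hX : spread phi X) (hX' : spread phi X') (hXX' : X <> X')
  (hp : points X p)
  (hGamma : \dim Gamma = 8%N) (hGammaS : (Gamma <= Sigma)%VS)
  (hX'Gamma : (X' <= Gamma)%VS) (hpGamma : ~ (p <= Gamma)%VS)
  (hr : \dim r = 1%N) (hqt : \dim qt = 1%N) (hrqt : r <> qt)
  (hTheta : (Gamma :&: X)%VS = (r + qt)%VS)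
  (hGamma' : \dim Gamma' = 9%N) (hGamma'S : (Gamma' :&: Sigma)%VS = Gamma)
  (* the Baer cone *)
  (hpi : \dim pi = 3%N) (hpiGamma' : (pi <= Gamma')%VS)
  (hpiS : ~ (pi <= Sigma)%VS)
  (hqtpi : (qt <= pi)%VS) (ht : points X' t) (htpi : (t <= pi)%VS)
  (hVb : subplane q pi Vb) (hVbinf : Vb `&` points (t + qt)%VS = [set qt])
  (hell : real_line q pi Vb ell) (htell : (t <= ell)%VS)
  (hs : (Vb `&` points ell) s)
  (* the point t~ *)
  (hl : \dim l = 2%N) (hpl : (p <= l)%VS)
  (hlreg : regulus phi (t + r)%VS = regulus phi l)
  (htt : tt = (l :&: X')%VS)
  (* the cone over three lines *)
  (hLi : forall i, \dim (Li i) = 2%N) (hLiX' : forall i, (Li i <= X')%VS)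
  (hLi0 : (\bigcap_i Li i)%VS = 0%VS)
  (htLi : forall i, ~ (t <= Li i)%VS) (httLi : forall i, ~ (tt <= Li i)%VS)
  (hh : points Gamma' h)
  (hhspan : ~ joinpts ([set X] `|` [set X'] `|` Vb) h)
  (hhS : ~ (h <= Sigma)%VS) :
  let Bbar := cone r ((Vb `\` points ell) `|` [set s]) in
  let Btilde := cone h [set P | exists i, points (Li i) P] `\` points Sigma in
  let B := (cone p (Bbar `|` Btilde) `\` points Sigma) `|` [set X] in
  (* Needed for minimality only: with z a common point of two of the lines, it
     says that t is not on the line joining z and <r, Z> /\ X', where Z <> X, X'
     is a spread element meeting <p, z>. *)
  let generic_lines := forall i j, i != j ->
    forall Z, spread phi Z -> Z <> X -> Z <> X' ->
      (Z :&: (p + (Li i :&: Li j)))%VS <> 0%VS -> ~ (t <= p + r + Z)%VS in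
  [/\ @blocking_set (BC phi) B,
      generic_lines -> @minimal_blocking_set (BC phi) B
    & forall B', @class_MPS (q ^ 6) (BC phi) B' -> ~ @equivalent (BC phi) B B'].
Proof.
move=> Bbar Btilde B generic_lines; subst Sigma.
have q1 : (1 < q)%N.
  case: hq => a [k [pa k0 ->]]; rewrite (leq_trans (prime_gt1 pa)) // -{1}(expn1 a).
  by rewrite leq_pexp2l // prime_gt0.
have cF : (3 < #|F|)%N by rewrite hF -(leq_exp2r 2 q (isT : 0 < 2)%N) in q1 *.
have [e0 hE] := vline_of_dim1 hh.1.
have e0S : e0 \notin limg phi by apply/negP; rewrite memvE -hE.
have dV : \dim {:V} = (3 * \dim {:L}).+1 by rewrite hV hL.
(* A provisional frame gives the properties of the spread before the adapted basis exists. *)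
have [ps0 fr0] := standard_frame hphi dV e0S.
have XX'0 x : x \in X -> x \in X' -> x = 0.
  by move=> xX xX'; apply: contrapT => /eqP x0; apply: hXX'; exact: (spread_meet fr0 hX hX' x0).
have XS := spread_limg fr0 hX; have X'S := spread_limg fr0 hX'.
have rX : (r <= X)%VS by have := capvSr Gamma X; rewrite hTheta subv_add => /andP[].
have qtX : (qt <= X)%VS by have := capvSr Gamma X; rewrite hTheta subv_add => /andP[].
have [dt tX'] := ht.
have tqt : t <> qt.
  move=> e; have [tv tE] := vline_of_dim1 dt.
  have tv0 : tv = 0 by apply: XX'0; rewrite memvE -tE // e.
  by move: dt; rewrite tE tv0 dim_vline eqxx.
have piS : (pi :&: limg phi)%VS = (t + qt)%VS.
  apply/eqP; rewrite eq_sym eqEdim subv_cap !subv_add htpi hqtpi (subv_trans tX') // (subv_trans qtX) //=.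
  have : (\dim (pi :&: limg phi) < \dim pi)%N.
    rewrite ltn_neqAle dimvS ?capvSl // andbT; apply/eqP=> e; apply: hpiS.
    have /eqP <- : (pi :&: limg phi == pi)%VS by rewrite eqEdim capvSl e leqnn.
    exact: capvSr.
  by rewrite dim_add_points // hpi ltnS.
have [sV [ds sell]] := hs.
have [dell ellpi cell] := hell.
(* Otherwise the real line would be the line at infinity of pi, with one point of V instead of q +
   1. *)
have qtell : ~ (qt <= ell)%VS.
  move=> qtell; have e : (t + qt)%VS = ell.
    by apply/eqP; rewrite eqEdim subv_add htell qtell dell dim_add_points.
  move: cell; rewrite -e hVbinf; have := @card_set1 _ qt; rewrite card_eq_sym => c1.
  move=> /(card_eq_trans c1)/card_eq_II[e1].
  by rewrite -e1 in q1.
have sS : ~ (s <= limg phi)%VS.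
  move=> sS; have : (Vb `&` points (t + qt)%VS) s.
    by split=> //; split=> //; rewrite -piS subv_cap sS (subv_trans sell).
  by rewrite hVbinf => e; apply: qtell; rewrite -e.
have [x2 sE] : exists x2, s = <[e0 + phi x2]>%VS.
  have [v ->] := affineP fr0 (conj ds sS); have := ps_limg fr0 v.
  by case/memv_imgP => x2 _ e; exists x2; rewrite /pt e.
have [pv pE] := vline_of_dim1 hp.1.
have pX : pv \in X by rewrite memvE -pE; case: hp.
have [x0 _ pvE] := memv_imgP (subvP XS _ pX).
have [tv tE] := vline_of_dim1 dt.
have tvX' : tv \in X' by rewrite memvE -tE.
have [x1 _ tvE] := memv_imgP (subvP X'S _ tvX').
have scaleZ (Z : {vspace V}) a w : spread phi Z -> phi w \in Z -> phi [ffun i => a * w i] \in Z.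
  case=> v _ hv /hv[b /hphi ->]; apply/hv; exists (a * b); congr (phi _).
  by apply/ffunP=> i; rewrite !ffunE mulrA.
have x00 : x0 != 0.
  by apply: contra_eqN hp.1; rewrite pE pvE => /eqP ->; rewrite linear0 dim_vline eqxx.
have x10 : x1 != 0.
  by apply: contra_eqN dt; rewrite tE tvE => /eqP ->; rewrite linear0 dim_vline eqxx.
rewrite pvE in pX; rewrite tvE in tvX'.
have scale0 (a : L) (w : {ffun 'I_3 -> L}) : w != 0 -> (forall i, a * w i = 0) -> a = 0.
  move=> w0 h0; apply: contraNeq w0 => a0; apply/eqP/ffunP=> i; rewrite ffunE.
  by apply/eqP; have /eqP := h0 i; rewrite mulf_eq0 (negPf a0).
(* In a relation with c nonzero, [x2] would be an [L]-combination of [x0] and [x1], so h would lie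
   in the join of X, X' and V; with c = 0 and b nonzero, X and X' would meet. *)
have indep v : comb x0 x1 x2 v = 0 -> v = 0.
  case: v => [[a b] c] /ffunP e.
  have {}e i : a * x0 i + b * x1 i + c * x2 i = 0 by have := e i; rewrite !ffunE.
  have c0 : c = 0.
    apply: contrapT => /eqP c0; apply: hhspan; split; first exact: hh.1.
    move=> U hU; have sU : (s <= U)%VS by apply: hU; right.
    have XU : (X <= U)%VS by apply: hU; left; left.
    have X'U : (X' <= U)%VS by apply: hU; left; right.
    have x2E : phi x2 = phi [ffun i => - (a / c) * x0 i] + phi [ffun i => - (b / c) * x1 i].
      rewrite -linearD; congr (phi _); apply/ffunP=> i; rewrite !ffunE.
      have ei : c * x2 i = - (a * x0 i + b * x1 i) by apply/eqP; rewrite -addr_eq0 addrC e.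
      by apply: (mulfI c0); rewrite ei; field.
    rewrite hE -memvE -(addrK (phi x2) e0); apply: memvB; first by rewrite memvE -sE.
    rewrite x2E; apply: memvD; first by apply: (subvP XU); exact: scaleZ.
    by apply: (subvP X'U); exact: scaleZ.
  have b0 : b = 0.
    apply: contrapT => /eqP b0; move/eqP: x10; apply; apply: hphi; rewrite linear0.
    apply: XX'0 => //.
    suff -> : x1 = [ffun i => - (a / b) * x0 i] by exact: scaleZ.
    apply/ffunP=> i; rewrite ffunE; apply: (mulfI b0).
    have ei : b * x1 i = - (a * x0 i).
      by apply/eqP; rewrite -addr_eq0 addrC; have := e i; rewrite c0 mul0r addr0 => ->.
    by rewrite ei; field.
  rewrite b0 c0 (scale0 a x0 x00) // => i.
  by have := e i; rewrite b0 c0 !mul0r !addr0.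
have [ps fr psE] := frame_of_basis hphi dV e0S indep.
have ps100 : ps (1, 0, 0) = phi x0.
  by rewrite psE; congr (phi _); apply/ffunP=> i; rewrite !ffunE /= !mul0r mul1r !addr0.
have ps010 : ps (0, 1, 0) = phi x1.
  by rewrite psE; congr (phi _); apply/ffunP=> i; rewrite !ffunE /= !mul0r mul1r addr0 add0r.
have ps001 : ps (0, 0, 1) = phi x2.
  by rewrite psE; congr (phi _); apply/ffunP=> i; rewrite !ffunE /= !mul0r mul1r !add0r.
have n100 : (1, 0, 0) != 0 :> L * L * L by apply/eqP=> -[/eqP]; rewrite oner_eq0.
have n010 : (0, 1, 0) != 0 :> L * L * L by apply/eqP=> -[/eqP]; rewrite oner_eq0.
have hXE x : x \in X <-> exists a, x = ps (a, 0, 0).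
  have r1 a : ray (1, 0, 0) a = (a, 0, 0) by rewrite /ray /= mulr1 !mulr0.
  rewrite (spread_generated fr hX _ n100) ?ps100 //.
  by split=> -[a ->]; exists a; rewrite r1.
have hX'E x : x \in X' <-> exists a, x = ps (0, a, 0).
  have r1 a : ray (0, 1, 0) a = (0, a, 0) by rewrite /ray /= mulr1 !mulr0.
  rewrite (spread_generated fr hX' _ n010) ?ps010 //.
  by split=> -[a ->]; exists a; rewrite r1.
have [rho rE] : exists rho, r = <[(ps (rho, 0, 0))%R]>%VS.
  have [rv rE] := vline_of_dim1 hr; have : rv \in X by rewrite memvE -rE.
  by case/hXE => rho e; exists rho; rewrite rE e.
have [tau qtE] : exists tau, qt = <[(ps (tau, 0, 0))%R]>%VS.
  have [qv qE] := vline_of_dim1 hqt; have : qv \in X by rewrite memvE -qE.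
  by case/hXE => tau e; exists tau; rewrite qE e.
have ps0E : ps (0, 0, 0) = 0 by exact: (linear0 ps).
have tau0 : tau != 0.
  by apply: contra_eqN hqt; rewrite qtE => /eqP ->; rewrite ps0E dim_vline eqxx.
have rho0 : rho != 0.
  by apply: contra_eqN hr; rewrite rE => /eqP ->; rewrite ps0E dim_vline eqxx.
have psZ (k : F) a : ps (k *: a, 0, 0) = k *: ps (a, 0, 0).
  by rewrite -linearZ; congr (ps _); rewrite -[RHS]/(k *: a, k *: 0, k *: 0) scaler0.
have psD a b : ps (a + b, 0, 0) = ps (a, 0, 0) + ps (b, 0, 0).
  by rewrite -linearD; congr (ps _); rewrite -[RHS]/(a + b, 0 + 0, 0 + 0) addr0.
(* Gamma meets X in the line joining r and q~, so p outside Gamma means that 1 is not in the span of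
   rho and tau. *)
have no1 (k k' : F) : 1 <> k *: rho + k' *: tau.
  move=> e; apply: hpGamma; rewrite pE pvE -ps100 e psD !psZ -memvE.
  have : k *: ps (rho, 0, 0) + k' *: ps (tau, 0, 0) \in (r + qt)%VS.
    by rewrite rE qtE memv_add ?memvZ ?memv_line.
  by rewrite -hTheta memv_cap => /andP[].
have rhoF : rho \notin 1%VS.
  apply/negP=> /vlineP[k e]; have k0 : k != 0.
    by apply: contraNneq rho0 => k0; rewrite e k0 scale0r.
  by apply: (no1 k^-1 0); rewrite scale0r addr0 e scalerA mulVf // scale1r.
pose U := (<[1 : L]> + <[rho]>)%VS.
have tauU : tau \notin U.
  apply/negP=> /memv_addP[_ /vlineP[k ->] [_ /vlineP[k' ->] e]].
  have [k0|k0] := eqVneq k 0.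
    apply: hrqt; apply/esym/point_sub_point => //.
    by rewrite qtE -memvE e k0 scale0r add0r psZ rE memvZ ?memv_line.
  apply: (no1 (- (k' / k)) k^-1); rewrite e scalerDr !scalerA mulVf // scale1r.
  by rewrite addrCA -scalerDl mulrC addNr scale0r addr0.
have dU : \dim U = 2%N.
  rewrite /U dim_add_points ?dim_vline ?oner_eq0 ?rho0 //.
  by move=> e; case/negP: rhoF; rewrite e memv_line.
have Ufull : (U + <[tau]>)%VS = fullv.
  apply/eqP; rewrite eqEdim subvf hL dimv_disjoint_sum ?dU ?dim_vline ?tau0 //.
  apply/eqP; rewrite -subv0; apply/subvP=> x /memv_capP[xU /vlineP[k xE]].
  by move: xU; rewrite xE rpredZeq (negPf tauU) orbF => /eqP ->; rewrite scale0r mem0v.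
have [ct [ctD ctZ ct_tau ker_ct ctU]] := functional_with_kernel tauU Ufull.
(* This map identifies [L] with X', turning the three lines into subspaces of [L]. *)
pose lam := linfun (ray_lin ps (0, 1, 0)).
have lamE y : lam y = ps (0, y, 0) by rewrite lfunE /= /ray /= mulr0 mulr1.
pose Lam i := (lam @^-1: Li i)%VS.
have hLam i y : (y \in Lam i) = (ps (0, y, 0) \in Li i) by rewrite -memv_preim lamE.
have LiX'E i x : x \in Li i -> exists y, x = ps (0, y, 0).
  by move=> /(subvP (hLiX' i))/hX'E.
have dLam i : \dim (Lam i) = 2%N.
  rewrite -(hLi i) -[in RHS](lpreimK (f := lam) (W := Li i)).
    rewrite limg_dim_eq // (_ : lker lam = 0%VS) ?capv0 //; apply/eqP/lker0P=> a b.
    by rewrite !lamE => /(ps_inj fr)[].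
  by apply/subvP=> x /LiX'E[y ->]; rewrite -lamE memv_img ?memvf.
have Lam0 y : (forall i, y \in Lam i) -> y = 0.
  move=> h0; have : ps (0, y, 0) \in (\bigcap_i Li i)%VS.
    by rewrite memvE; apply/subv_bigcapP=> i _; rewrite -memvE -hLam.
  by rewrite hLi0 memv0 -ps0E => /eqP/(ps_inj fr)[].
have sB : bpt ps e0 tau 0 0 = s by rewrite /bpt /pt !scale0r ps001 sE.
have qtB : dir ps tau 1 0 = qt by rewrite /dir scale1r scale0r qtE.
have tB : dir ps tau 0 1 = t by rewrite /dir scale0r scale1r ps010 tE tvE.
have spi := subv_trans sell ellpi.
have piB : bpi ps e0 tau = pi.
  rewrite /bpi sB qtB tB; apply/eqP; rewrite eqEdim !subv_add hqtpi htpi spi hpi /=.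
  rewrite dimv_disjoint_sum ?ds ?[(qt + t)%VS]addvC ?dim_add_points //.
  apply/eqP; rewrite -subv0 -piS; apply/subvP=> x; rewrite sE.
  move=> /memv_capP[/memv_capP[_ xS] /vlineP[k xE]]; rewrite memv0 xE.
  move: xS; rewrite xE rpredZeq => /orP[/eqP->|h1]; first by rewrite scale0r.
  by case: sS; rewrite sE -memvE.
have ellB : (t + s)%VS = ell.
  apply/eqP; rewrite eqEdim subv_add htell sell dell dim_add_points //.
  by move=> e; apply: sS; rewrite -e (subv_trans tX').
have hVb' : subplane q (bpi ps e0 tau) Vb by rewrite piB.
have hVbinf' : Vb `&` points (dir ps tau 0 1 + dir ps tau 1 0)%VS = [set dir ps tau 1 0].
  by rewrite tB qtB.
have hell' : real_line q (bpi ps e0 tau) Vb (dir ps tau 0 1 + bpt ps e0 tau 0 0)%VS.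
  by rewrite piB tB sB ellB.
have hs' : Vb (bpt ps e0 tau 0 0) by rewrite sB.
have [f [A [C [A0 f0 hf fA]]]] := baer_graph fr q1 hF tau0 hVb' hVbinf' hell' hs'.
have BE : B = graph_cone ps e0 X ct f Lam.
  have <- := cone_normal_form fr tau0 hVb' hVbinf' X (erefl U) ctD ctZ ct_tau ker_ct ctU
    f0 hf hLam hLi LiX'E.
  by rewrite /B /Bbar /Btilde sB tB ellB pE pvE -ps100 rE hE.
have Bbl : @blocking_set (BC phi) B.
  by rewrite BE; exact: (graph_cone_blocking fr hL ct f hXE dLam Lam0).
split=> //; last first.
  apply: not_equivalent_MPS => //; first by case: Bbl.
  by rewrite BE -hF; exact: (card_graph_cone fr hL ct f hXE dLam Lam0).
move=> gen; rewrite BE.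
apply: (graph_cone_minimal fr cF hL hXE dLam Lam0 _ ker_ct ctD ctZ ct_tau rhoF _ A0 fA).
  by rewrite dU.
(* Suppose a vertex y has 1/y in <1, rho>. The spread element Z generated by (1, y, 0) meets the
   line from p to the vertex and contains (1/y, 1, 0). Subtracting (1/y, 0, 0), which lies in p + r,
   puts t in p + r + Z, against [gen]. *)
move=> i j y ij y0 yi yj; apply/negP=> yU.
have ny : (1, y, 0) != 0 :> L * L * L by apply/eqP=> -[/eqP]; rewrite oner_eq0.
have [Z [sZ hZ]] := spread_exists fr ny.
have pyZ : ps (1, y, 0) \in Z by apply/hZ; exists 1; rewrite /ray /= !mul1r.
apply: (gen i j ij Z sZ).
- move=> e; move: pyZ; rewrite e => /hXE[a /(ps_inj fr)[_ /eqP]].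
  by rewrite (negPf y0).
- move=> e; move: pyZ; rewrite e => /hX'E[a /(ps_inj fr)[/eqP]].
  by rewrite oner_eq0.
- move=> e; have : ps (1, y, 0) \in (Z :&: (p + (Li i :&: Li j)))%VS.
    rewrite memv_cap pyZ (_ : (1, y, 0) = (1, 0, 0) + (0, y, 0)).
      rewrite linearD memv_add //; first by rewrite pE pvE -ps100 memv_line.
      by rewrite memv_cap -!hLam yi.
    by rewrite -[RHS]/(1 + 0, 0 + y, 0 + 0) !addr0 add0r.
  by rewrite e memv0 -ps0E => /eqP/(ps_inj fr)[/eqP]; rewrite oner_eq0.
case/memv_addP: yU => _ /vlineP[k ->] [_ /vlineP[k' ->] yE].
rewrite tE tvE -ps010 -memvE.
have -> : ps (0, 1, 0) = - (k *: ps (1, 0, 0) + k' *: ps (rho, 0, 0)) + ps (ray (1, y, 0) y^-1).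
  rewrite -!psZ -psD -yE /ray /= mulVf // mulr1 mulr0 -linearN -linearD; congr (ps _).
  by rewrite -[RHS]/(- y^-1 + y^-1, - 0 + 1, - 0 + 0) addNr oppr0 !add0r.
rewrite memv_add //; last by apply/hZ; exists y^-1.
by rewrite memvN memv_add // ?pE ?pvE -?ps100 ?rE memvZ ?memv_line.
Qed.
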